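(* For $n\ge1$ and a partition $\nu=(\nu_1,\ldots,\nu_k)$ of $n$, set \[ G_\nu(t)=\Big(tA_{k-1}(t)\prod_{i=1}^k[\nu_i]_t\Big)_{g(\nu)}, \] where $g(\nu)=\gcd(\nu_1,\dots,\nu_k)$. Then \[ \sum_{j=0}^{n-1}Q_{(n),j}t^j=\sum_{\nu\vdash n}z_\nu^{-1}G_\nu(t)\,{\sf p}_\nu. \]
   Context: Permutations act on the right on $[n]$; ${\rm Exc}(\sigma)=\{i\in[n-1]:i\sigma>i\}$, ${\rm exc}(\sigma)=|{\rm Exc}(\sigma)|$. The Eulerian polynomial is $A_m(t)=\sum_{\sigma\in S_m}t^{{\rm exc}(\sigma)}$ for $m\ge1$ and $A_0(t)=1$. $[m]_t=1+t+\cdots+t^{m-1}$. For a power series $f(t)=\sum_j a_jt^j$ and a positive integer $k$, $f(t)_k=\sum_{j:\gcd(j,k)=1}a_jt^j$ (with $\gcd(0,k)=k$). $S_{\lambda,j}$ denotes the set of $\sigma\in S_n$ of cycle type $\lambda$ with ${\rm exc}(\sigma)=j$; $(n)$ is the one-part partition, so $S_{(n),j}$ consists of $n$-cycles. For $\sigma\in S_n$ let $w(\sigma)$ be the word obtained from $\sigma_1\cdots\sigma_n$ ($\sigma_i=i\sigma$) by replacing $\sigma_i$ with $\overline{\sigma_i}$ whenever $i\in{\rm Exc}(\sigma)$; order letters $\overline1<\cdots<\overline n<1<\cdots<n$, and let ${\rm Dex}(\sigma)=\{i\in[n-1]:w_i>w_{i+1}\}$. For $S\subseteq[n-1]$, $F_S=\sum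 x_{j_1}\cdots x_{j_n}$ over $j_1\ge\cdots\ge j_n\ge1$ with $j_i>j_{i+1}$ for $i\in S$. Then $Q_{\lambda,j}=\sum_{\sigma\in S_{\lambda,j}}F_{{\rm Dex}(\sigma)}$ (a symmetric function). ${\sf p}_\nu$ is the power sum symmetric function and $z_\nu=\prod_i i^{m_i(\nu)}m_i(\nu)!$ where $m_i(\nu)$ is the number of parts of $\nu$ equal to $i$.
   Formalization: The identity is proved for n ≥ 2 instead of n ≥ 1, since for n = 1 it fails with the given definitions: the left side is Q_{(1),0} = p_1 while the right side is t·p_1. *)

(* Defs.v *)
From mathcomp Require Import all_boot all_order all_fingroup all_algebra.
From mathcomp Require Import finmap multiset.

Set Implicit Arguments.
Unset Strict Implicit.
Unset Printing Implicit Defensive.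

Import GRing.Theory.

Local Open Scope fset_scope.
Local Open Scope mset_scope.
Local Open Scope ring_scope.

(** Polynomials in t over the rationals; the variable t is ['X : {poly rat}]. *)

Definition qint (m : nat) : {poly rat} := \sum_(i < m) 'X^i.

(* [gcdn 0 k = k], so the term of degree 0 is kept exactly when k = 1. *)
Definition coprime_part (k : nat) (f : {poly rat}) : {poly rat} :=
  \poly_(j < size f) (if gcdn j k == 1%N then f`_j else 0).

(** Permutations.  The position or value i of [n] = {1, ..., n} is the ordinal
    i - 1 of ['I_n]; [s i] is the image of i under the right action of s. *)

(* The last position is never an excedance, so ranging over all of ['I_n]
   instead of the first n - 1 positions is harmless. *)
Definition Exc (n : nat) (s : 'S_n) : {set 'I_n} := [set i : 'I_n | (i < s i)%N].

Definition exc (n : nat) (s : 'S_n) : nat := #|Exc s|.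

(* ['S_0] has exactly one element, so [eulerian 0 = 1]; see [eulerian0]. *)
Definition eulerian (m : nat) : {poly rat} := \sum_(s : 'S_m) 'X^(exc s).

Definition cycle_type (n : nat) (s : 'S_n) : seq nat :=
  sort geq [seq #|C| | C : {set 'I_n} in porbits s].

(* An element i of ['I_n.-1] stands for the position i + 1 of [n-1]; as elements
   of ['I_n], [pos i] and [pos_next i] are that position and the next one. *)
Definition pos (n : nat) (i : 'I_n.-1) : 'I_n := widen_ord (leq_pred n) i.

Lemma pos_next_subproof (n : nat) (i : 'I_n.-1) : (i.+1 < n)%N.
Proof. by rewrite -ltn_predRL. Qed.

Definition pos_next (n : nat) (i : 'I_n.-1) : 'I_n :=
  Ordinal (pos_next_subproof i).

(* A letter is a pair (b, a), barred when b is true. *)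
Definition letter (n : nat) : Type := (bool * 'I_n)%type.

Definition lt_letter (n : nat) (u v : letter n) : bool :=
  if u.1 == v.1 then (u.2 < v.2)%N else u.1.

Definition word (n : nat) (s : 'S_n) (i : 'I_n) : letter n := (i \in Exc s, s i).

Definition Dex (n : nat) (s : 'S_n) : {set 'I_n.-1} :=
  [set i | lt_letter (word s (pos_next i)) (word s (pos i))].

(** Formal power series over Q[t] in the variables x_1, x_2, ...  The variable
    x_(i+1) is indexed by the natural number i, the monomial
    x_(j_1) ... x_(j_n) is the multiset of its indices, and a series is the
    function mapping each monomial to its coefficient. *)

Definition pser : Type := {mset nat} -> {poly rat}.

Definition mdivisors (m : {mset nat}) : {fset {mset nat}} :=
  [fset seq_mset (mask (val b) m) | b in {: (size m).-tuple bool}].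

Definition pser1 : pser := fun m => (m == mset0)%:R.

(* Each factorisation m = a b is counted once; see [in_mdivisors]. *)
Definition pser_mul (f g : pser) : pser :=
  fun m => \sum_(a <- mdivisors m) f a * g (m `\` a).

(* [j] lists the indices of x_(j_1) ... x_(j_n) subject to
   j_1 >= ... >= j_n and j_i > j_(i+1) for i in S. *)
Definition Fword (n : nat) (S : {set 'I_n.-1}) (j : seq nat) : bool :=
  (size j == n) &&
  [forall i : 'I_n.-1,
     if i \in S then (nth 0%N j (pos_next i) < nth 0%N j (pos i))%N
     else (nth 0%N j (pos_next i) <= nth 0%N j (pos i))%N].

(* The index words of the monomial m are the permutations of m, each listed once
   by [permutations]; see [mem_permutations_mset]. *)
Definition Fqsym (n : nat) (S : {set 'I_n.-1}) : pser :=
  fun m => (count (Fword S) (permutations m))%:R.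

Definition Qsym (n : nat) (lam : seq nat) (j : nat) : pser :=
  fun m => \sum_(s : 'S_n | (cycle_type s == lam) && (exc s == j)) Fqsym (Dex s) m.

(* The sum of x_i ^ r over all i, for r > 0: only the indices i occurring in m
   can contribute to the coefficient of m. *)
Definition psum1 (r : nat) : pser :=
  fun m => \sum_(i <- finsupp m) (m == msetn r i)%:R.

Definition psum (nu : seq nat) : pser :=
  foldr (fun r f => pser_mul (psum1 r) f) pser1 nu.

(** Integer partitions, as nonincreasing sequences of positive integers. *)

Definition is_intpart (n : nat) (nu : seq nat) : bool :=
  [&& sorted geq nu, 0%N \notin nu & sumn nu == n].

(* A partition of n has at most n parts, all at most n; see [mem_intparts]. *)
Definition intparts (n : nat) : seq (seq nat) :=
  [seq nu <- [seq map val (val b) | b : {bseq n of 'I_n.+1}] | is_intpart n nu].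

Definition zee (nu : seq nat) : nat :=
  (\prod_(i <- undup nu) (i ^ count_mem i nu * (count_mem i nu)`!))%N.

Definition gcds (nu : seq nat) : nat := \big[gcdn/0%N]_(i <- nu) i.

Definition Gpoly (nu : seq nat) : {poly rat} :=
  coprime_part (gcds nu)
    ('X * eulerian (size nu).-1 * \prod_(i <- nu) qint i).

Lemma eulerian0 : eulerian 0 = 1.
Proof.
rewrite /eulerian (big_pred1 1%g) => [|s]; last first.
  by apply/esym/eqP/permP => -[].
suff -> : exc (1%g : 'S_0) = 0%N by rewrite expr0.
by apply: eq_card0 => -[].
Qed.

Lemma in_mdivisors (m a : {mset nat}) : (a \in mdivisors m) = (a `<=` m).
Proof.
apply/imfsetP/idP => [[b _ ->] | sub].
  apply/msubsetP => x; rewrite mset_seqE -count_mem_mset.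
  exact/leq_count_subseq/mask_subseq.
have: exists2 s, subseq s m & perm_eq a s.
  by apply/count_subseqP => x; rewrite !count_mem_mset; apply/msubsetP.
case=> s /subseqP[b sb ->] /eq_seq_msetP; rewrite seq_mset_id => ->.
have sz : size b == size m by rewrite sb.
by exists (Tuple sz).
Qed.

Lemma mem_permutations_mset (m : {mset nat}) (j : seq nat) :
  (j \in permutations m) = (seq_mset j == m).
Proof.
rewrite mem_permutations; apply/idP/eqP => [/eq_seq_msetP -> | <-].
  exact: seq_mset_id.
by rewrite perm_sym perm_eq_seq_mset.
Qed.

Lemma mem_intparts (n : nat) (nu : seq nat) :
  (nu \in intparts n) = is_intpart n nu.
Proof.
rewrite mem_filter andb_idr // => /and3P[_ nz /eqP sn].
have le1 x : x \in nu -> (x <= n)%N.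
  rewrite -sn; elim: nu {nz sn} => //= y nu IH; rewrite inE.
  by case/orP => [/eqP -> | /IH le]; rewrite ?leq_addr // (leq_trans le) ?leq_addl.
have le2 : (size nu <= n)%N.
  rewrite -sn; elim: nu nz {sn le1} => //= y nu IH.
  by rewrite inE negb_or eq_sym -lt0n => /andP[y0 /IH le]; rewrite -add1n leq_add.
have sz : (size [seq inord x : 'I_n.+1 | x <- nu] <= n)%N by rewrite size_map.
apply/imageP; exists (Bseq sz) => //=.
rewrite -map_comp -[LHS]map_id; apply/eq_in_map => x /le1 xn /=.
by rewrite inordK.
Qed.

Lemma intparts_uniq (n : nat) : uniq (intparts n).
Proof.
rewrite filter_uniq // map_inj_uniq ?enum_uniq // => b c /inj_map e.
exact/val_inj/e/val_inj.
Qed.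

(* The power sum expansion of \sum_j t^j Q_((n),j) needs n >= 2: for n = 1 its two
   sides are p_1 and t p_1. *)
Lemma expansion_fails_at_1 :
  exists m : {mset nat},
    \sum_(j < 1) 'X^j * Qsym 1 [:: 1%N] j m <>
    \sum_(nu <- intparts 1) ((zee nu)%:R^-1 : rat) *: (Gpoly nu * psum nu m).
Proof.
exists [mset 0%N]; apply/eqP; apply: contraTneq isT => e.
have {e} := congr1 (fun p : {poly rat} => p.[0]) e.
rewrite !horner_sum [RHS]big1 => [|nu _]; last first.
  rewrite hornerE hornerM [(Gpoly nu).[0]]horner_coef0 coef_poly.
  by rewrite -mulrA coefXM !if_same mul0r mulr0.
have s1 (s : 'S_1) : s = 1%g by apply/permP => i; rewrite !ord1.
have ct : cycle_type (1%g : 'S_1) = [:: 1%N].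
  have cardC (C : {set 'I_1}) : C \in porbits (1%g : 'S_1) -> #|C| = 1%N.
    case/imsetP => i _ ->; apply/eqP/cards1P; exists i.
    by apply/setP => k; rewrite !inE !ord1 porbit_id eqxx.
  have : size (image (fun C : {set 'I_1} => #|C|) (porbits (1%g : 'S_1))) = 1%N.
    rewrite size_image; apply/eqP/cards1P; exists (porbit 1%g ord0).
    apply/setP => C; rewrite !inE; apply/imsetP/eqP => [[i _ ->]|->].
      by rewrite ord1.
    by exists ord0.
  rewrite /cycle_type.
  have : {in image (fun C : {set 'I_1} => #|C|) (porbits (1%g : 'S_1)),
          forall x, x = 1%N} by move=> x /imageP[C /cardC ? ->].
  by case: (image _ _) => [|x [|]] //= /(_ x (mem_head _ _)) ->.
have ex : exc (1%g : 'S_1) = 0%N.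
  by apply: eq_card0 => i; rewrite !inE perm1 ltnn.
rewrite big_ord1 expr0 mul1r /Qsym (big_pred1 1%g) => [|s]; last first.
  by rewrite (s1 s) ct ex /= !eqxx.
rewrite /Fqsym enum_msetn (_ : permutations _ = [:: [:: 0%N]]) //=.
rewrite (_ : Fword _ _ = true) ?hornerE; first by move/eqP; rewrite oner_eq0.
by rewrite /Fword eqxx; apply/forallP => -[].
Qed.

(* Main.v *)
Require Import Defs.
From mathcomp Require Import all_boot all_order all_fingroup all_algebra.
From mathcomp Require Import finmap multiset.
From mathcomp Require Import zify ring.

(** Reading off the letters x_(j_i), barred at the excedances, along the cycle turns
    the coefficient of x^m in \sum_j Q_((n),j) t^j into a count of primitive cyclic
    words in barred and unbarred letters, where a barred letter is followed by a
    letter at most as large and an unbarred one by a letter at least as large, and t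
    marks the bars.  Every word is a power of a primitive one, so it is enough to sum
    over all such words w of length n.  Summing over the bars, consecutive letters
    a, a' contribute 1, t or 1 + t, and each of these is a sum over b >= 0 of
    t^b times 0, 1 or 1 - t, where b is read as a number of separators put between
    the two letters.  For a fixed total number r > 0 of separators, rotating the
    word so that it starts at a separator instead of a letter costs a factor n / r
    and leaves a sequence of r multisets of letters, each counted with weight (1 - t) per
    distinct letter.  Hence the sum over all words is
      p_n + \sum_(r > 0) (n / r) t^r [z^n] \prod_i ((1 - t z x_i) / (1 - z x_i))^r.
    The coefficient of z^n is \sum_nu z_nu^-1 \prod_i r (1 - t^nu_i) p_nu, and
    \sum_r r^(k-1) t^r = t A_(k-1)(t) / (1 - t)^k.  Passing to primitive words keeps
    exactly the terms with gcd(r, g(nu)) = 1. *)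

Set Implicit Arguments.
Unset Strict Implicit.
Unset Printing Implicit Defensive.

Import GRing.Theory Num.Theory.

Local Open Scope ring_scope.

(** * Congruence modulo t^M and Eulerian polynomials *)

Section Truncation.

Variable R : comNzRingType.
Implicit Types (f g : {poly R}) (M : nat).

(** Infinite series in t are truncated to finite sums and compared below degree M; letting M vary
    gives exact identities through [eqm_eq]. *)
Definition eqm M f g := forall j, (j < M)%N -> f`_j = g`_j.

Lemma eqm_refl M f : eqm M f f. Proof. by []. Qed.

Lemma eqm_sym M f g : eqm M f g -> eqm M g f.
Proof. by move=> e j /e. Qed.

Lemma eqm_trans M g f h : eqm M f g -> eqm M g h -> eqm M f h.
Proof. by move=> e1 e2 j lt; rewrite e1 // e2. Qed.

Lemma eqmD M f1 f2 g1 g2 : eqm M f1 f2 -> eqm M g1 g2 -> eqm M (f1 + g1) (f2 + g2).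
Proof. by move=> e1 e2 j lt; rewrite !coefD e1 // e2. Qed.

Lemma eqmM M f1 f2 g1 g2 : eqm M f1 f2 -> eqm M g1 g2 -> eqm M (f1 * g1) (f2 * g2).
Proof.
move=> e1 e2 j lt; rewrite !coefM; apply: eq_bigr => i _.
by rewrite e1 ?e2 //; have := ltn_ord i; lia.
Qed.

Lemma eqmZ M (a : R) f g : eqm M f g -> eqm M (a *: f) (a *: g).
Proof. by move=> e j lt; rewrite !coefZ e. Qed.

Lemma eqm_sum M I (r : seq I) (P : pred I) (F G : I -> {poly R}) :
  (forall i, P i -> eqm M (F i) (G i)) ->
  eqm M (\sum_(i <- r | P i) F i) (\sum_(i <- r | P i) G i).
Proof. by move=> e j lt; rewrite !coef_sum; apply: eq_bigr => i /e ->. Qed.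

Lemma eqm_prod M I (r : seq I) (P : pred I) (F G : I -> {poly R}) :
  (forall i, P i -> eqm M (F i) (G i)) ->
  eqm M (\prod_(i <- r | P i) F i) (\prod_(i <- r | P i) G i).
Proof.
move=> e; elim: r => [|x r IH]; rewrite ?big_nil // !big_cons.
by case: ifP => // /e; move/eqmM; apply.
Qed.

Lemma eqm_Xn0 M k f : (M <= k)%N -> eqm M ('X^k * f) 0.
Proof. by move=> le j lt; rewrite coefXnM coef0 (leq_trans lt le). Qed.

Lemma eqm_eq f g : (forall M, eqm M f g) -> f = g.
Proof. by move=> e; apply/polyP => j; apply: (e j.+1). Qed.

Lemma eqm_Xderiv M f g : eqm M f g -> eqm M ('X * f^`()) ('X * g^`()).
Proof.
move=> e [|j] lt; rewrite !coefXM //= !coef_deriv e //.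
Qed.

Lemma eqm_comp_Xn M d f g : (0 < d)%N -> eqm M f g -> eqm M (f \Po 'X^d) (g \Po 'X^d).
Proof.
move=> d0 e j lt; rewrite !coef_comp_poly_Xn //; case: ifP => // _.
by apply: e; apply: leq_ltn_trans (leq_div _ _) lt.
Qed.

Lemma eqm_geom M : eqm M ((1 - 'X) * \sum_(b < M) 'X^b) 1.
Proof.
have -> : (1 - 'X) * \sum_(b < M) 'X^b = 1 - 'X^M :> {poly R}.
  elim: M => [|M IH]; first by rewrite big_ord0 expr0; ring.
  rewrite big_ord_recr /= mulrDr IH exprS; ring.
by move=> j lt; rewrite coefB coefXn (ltn_eqF lt) subr0.
Qed.

End Truncation.

(** Inserting a new maximum into a cycle right after [j] creates an excedance exactly when [j] was
    not one already; as a fixed point it creates none. So a permutation with e excedances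
    contributes t^e (1 + e + (k - e) t). *)
Lemma eulerian_rec k :
  eulerian k.+1 = (1 + k%:R * 'X) * eulerian k + 'X * (1 - 'X) * (eulerian k)^`().
Proof.
(* This sends [j] to the new maximum and, for [j] below it, the maximum to the old image of [j]. *)
pose tau (j : 'I_k.+1) (s : 'S_k) : 'S_k.+1 :=
  (tperm j ord_max * lift_perm ord_max ord_max s)%g.
have tauK j s : tau j s j = ord_max.
  by rewrite permM tpermL lift_perm_id.
have tau_max s : tau ord_max s = lift_perm ord_max ord_max s.
  by rewrite /tau tperm1 mul1g.
have e1 s : exc (tau ord_max s) = exc s.
  rewrite tau_max /exc.
  rewrite -(card_imset (mem (Exc s)) (@lift_inj _ ord_max)).
  apply: eq_card => i; rewrite inE; apply/idP/imsetP.
    case: (unliftP ord_max i) => [i' ->|->].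
      rewrite lift_perm_lift !lift_max => lt; by exists i'; rewrite ?inE.
    by rewrite lift_perm_id ltnn.
  by case=> i'; rewrite inE => lt ->; rewrite lift_perm_lift !lift_max.
have e2 s (j : 'I_k) : exc (tau (lift ord_max j) s) = (exc s + (j \notin Exc s))%N.
  have -> : exc (tau (lift ord_max j) s) = #|j |: Exc s|.
    rewrite /exc -(card_imset (mem (j |: Exc s)) (@lift_inj _ ord_max)).
    apply: eq_card => i; rewrite inE; apply/idP/imsetP.
      case: (unliftP ord_max i) => [i' ->|->].
        have [->|ne] := eqVneq i' j; first by exists j; rewrite ?setU11.
        rewrite permM tpermD ?lift_perm_lift ?lift_max; last first.
        - by rewrite neq_lift.
        - by rewrite (inj_eq lift_inj) eq_sym.
        by move=> lt; exists i' => //; rewrite !inE lt orbT.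
      by rewrite ltnNge -ltnS ltn_ord.
    case=> i'; rewrite !inE => /orP[/eqP ->|lt] ->.
      by rewrite tauK lift_max /=.
    have [->|ne] := eqVneq i' j; first by rewrite tauK lift_max /=.
    rewrite permM tpermD ?lift_perm_lift ?lift_max //.
    - by rewrite (inj_eq lift_inj) eq_sym.
    - by rewrite neq_lift.
  by rewrite cardsU1 addnC.
have tau_inj : injective (fun js : 'I_k.+1 * 'S_k => tau js.1 js.2).
  move=> [i s] [j u] /= e.
  have ij : i = j by apply: (@perm_inj _ (tau i s)); rewrite tauK e tauK.
  rewrite {i}ij in e *; congr pair; apply/permP => x.
  move/mulgI/permP/(_ (lift ord_max x)): e.
  by rewrite !lift_perm_lift => /lift_inj.
have tau_bij : bijective (fun js : 'I_k.+1 * 'S_k => tau js.1 js.2).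
  apply: inj_card_bij tau_inj _.
  by rewrite card_prod card_ord !card_Sn factS.
rewrite {1}/eulerian (reindex _ (onW_bij _ tau_bij)) /=.
rewrite -(pair_bigA _ (fun j s => 'X^(exc (tau j s)))) /= exchange_big /=.
rewrite /eulerian raddf_sum !mulr_sumr -big_split /=; apply: eq_bigr => s _.
rewrite big_ord_recr /= e1 derivXn.
have -> : \sum_(i < k) 'X^(exc (tau (widen_ord (leqnSn k) i) s)) =
          \sum_(i < k) 'X^(exc s) * (if i \in Exc s then 1 else 'X) :> {poly rat}.
  apply: eq_bigr => i _.
  have -> : widen_ord (leqnSn k) i = lift ord_max i.
    by apply: ord_inj; rewrite lift_max.
  by rewrite e2; case: (i \in _); rewrite ?addn0 ?mulr1 ?addn1 ?exprSr.
rewrite -mulr_sumr (bigID (mem (Exc s))) /=.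
rewrite (eq_bigr (fun=> 1)) => [|i ->] //.
rewrite [X in _ * (_ + X)](eq_bigr (fun=> 'X)) => [|i /negbTE ->] //.
rewrite !sumr_const -/(exc s).
have cE : (#|[pred i | i \notin Exc s]| + exc s = k)%N.
  by rewrite addnC -[RHS]card_ord -(cardC (mem (Exc s))).
have -> : k%:R = (#|[pred i | i \notin Exc s]| + exc s)%:R :> {poly rat} by rewrite cE.
move: #|_| (exc s) => a b.
case: b => [|b] /=; first by rewrite mulr0n; ring.
by rewrite exprS; ring.
Qed.

(** The classical series \sum_r r^k t^r = t A_k(t) / (1 - t)^(k+1), cleared of denominators. The
    operator t d/dt raises the power of r by one, which matches [eulerian_rec]. *)
Lemma eulerian_series M k :
  eqm M ('X * eulerian k) ((1 - 'X) ^+ k.+1 * \sum_(1 <= r < M) r%:R ^+ k *: 'X^r).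
Proof.
elim: k => [|k IH].
  rewrite eulerian0 mulr1 expr1.
  under eq_bigr do rewrite expr0 scale1r.
  case: M => [|M] // ; rewrite big_add1 /= big_mkord.
  under eq_bigr do rewrite exprS.
  rewrite -mulr_sumr mulrCA; case=> [|j] lt; rewrite coefXM coefX //=.
  by rewrite eqm_geom // coef1.
(* The recurrence is expressed through t A_k alone, so that the induction hypothesis and its image
   under t d/dt both apply. *)
have -> : 'X * eulerian k.+1 = k.+1%:R * 'X * ('X * eulerian k) +
    (1 - 'X) * ('X * ('X * eulerian k)^`()).
  by rewrite eulerian_rec derivM derivX -(addn1 k) natrD; ring.
set S := \sum_(1 <= r < M) _ in IH.
set S' := \sum_(1 <= r < M) _.
have SS : 'X * S^`() = S'.
  rewrite /S raddf_sum mulr_sumr; apply: eq_big_nat => r /andP[r0 _].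
  rewrite [X in 'X * X]derivZ derivXn -scalerAr; case: r r0 => // r _.
  by rewrite mulrnAr -exprS -scaler_nat scalerA -exprSr.
have IH' := eqm_Xderiv IH.
apply: eqm_trans (eqmD (eqmM (eqm_refl _) IH) (eqmM (eqm_refl _) IH')) _.
rewrite derivM mulrDr [X in _ * (_ + X)]mulrCA SS deriv_exp derivB derivC derivX sub0r /=.
set E := (1 - 'X) ^+ k.+1; rewrite exprS -/E.
have -> : E = (1 - 'X) * (1 - 'X) ^+ k by rewrite -exprS.
by move=> j _; congr (polyseq _)`_j; ring.
Qed.

(** * Power sums and partitions *)

(** A common index range allows two sequences to be compared factor by factor; an absent value i
    contributes i^0 0! = 1. *)
Lemma zee_prod K (nu : seq nat) : all (fun i => i < K)%N nu ->
  zee nu = (\prod_(i < K) (i ^ count_mem (val i) nu * (count_mem (val i) nu)`!))%N.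
Proof.
move=> /allP lt; rewrite -(big_mkord xpredT
  (fun i => i ^ count_mem i nu * (count_mem i nu)`!)%N) /=.
rewrite (bigID (fun i => i \in nu)) /= [X in (_ * X)%N]big1 ?muln1; last first.
  by move=> i /count_memPn ->.
rewrite -big_filter; apply: perm_big; apply: uniq_perm.
- exact: undup_uniq.
- by rewrite filter_uniq ?iota_uniq.
move=> i; rewrite mem_undup mem_filter mem_index_iota /=.
by case: (boolP (i \in nu)) => // /lt.
Qed.

Lemma zee_perm (mu nu : seq nat) : perm_eq mu nu -> zee mu = zee nu.
Proof.
move=> e; rewrite /zee (perm_big (undup nu)) /=; last first.
  by apply: perm_undup; apply: perm_mem.
by apply: eq_bigr => i _; rewrite (seq.permP e).
Qed.

Lemma mem_leq_sumn i (nu : seq nat) : i \in nu -> (i <= sumn nu)%N.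
Proof. by move/perm_to_rem/perm_sumn => -> /=; rewrite leq_addr. Qed.

Lemma zee_cons k (nu : seq nat) :
  zee (k :: nu) = (k * (count_mem k nu).+1 * zee nu)%N.
Proof.
pose K := (sumn (k :: nu)).+1.
have lt : all (fun i => i < K)%N (k :: nu) by apply/allP => i /mem_leq_sumn.
have kK : (k < K)%N by case/andP: lt.
rewrite (zee_prod lt) (@zee_prod K nu); last by case/andP: lt.
rewrite (bigD1 (Ordinal kK)) //= [in RHS](bigD1 (Ordinal kK)) //= eqxx add1n.
rewrite factS expnS !mulnA; congr (_ * _)%N; first by lia.
apply: eq_bigr => i ne; rewrite (_ : (k == i) = false) //.
by apply/negbTE; rewrite eq_sym -(inj_eq val_inj) in ne.
Qed.

Lemma zee_gt0 (nu : seq nat) : 0%N \notin nu -> (0 < zee nu)%N.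
Proof.
elim: nu => [|k nu IH]; first by rewrite /zee big_nil.
rewrite inE negb_or zee_cons => /andP[k0 /IH]; rewrite !muln_gt0 /= => ->.
by rewrite lt0n eq_sym k0.
Qed.

Lemma zee_scale d (nu : seq nat) : (0 < d)%N ->
  zee [seq (d * i)%N | i <- nu] = (d ^ size nu * zee nu)%N.
Proof.
move=> d0; elim: nu => [|k nu IH]; first by rewrite /zee /= !big_nil.
rewrite /= !zee_cons IH expnS.
have -> : count_mem (d * k)%N [seq (d * i)%N | i <- nu] = count_mem k nu.
  by rewrite count_map; apply: eq_count => i /=; rewrite eqn_pmul2l.
by rewrite !mulnA; congr (_ * _)%N; rewrite -!mulnA; congr (_ * _)%N; lia.
Qed.

Section PowerSums.

Variable L : nat.
Implicit Types mu : {ffun 'I_L -> nat}.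

Definition dec mu k a : {ffun 'I_L -> nat} := [ffun b => mu b - (k * (b == a))%N]%N.

(* The coefficient of the monomial with exponents [mu] in the power sum [nu]. *)
Fixpoint psumf (nu : seq nat) mu : nat :=
  if nu is k :: nu' then (\sum_(a | k <= mu a) psumf nu' (dec mu k a))%N
  else (mu == [ffun=> 0%N]).

Lemma sum_dec mu k a : (k <= mu a)%N ->
  (\sum_b dec mu k a b = \sum_b mu b - k)%N.
Proof.
move=> le; rewrite (bigD1 a) //= [in RHS](bigD1 a) //= ffunE eqxx muln1.
rewrite (eq_bigr mu) => [|b /negbTE ne]; last by rewrite ffunE ne muln0 subn0.
by rewrite addnBAC.
Qed.

Lemma psumf_sum nu mu : psumf nu mu != 0%N -> (\sum_a mu a = sumn nu)%N.
Proof.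
elim: nu mu => [|k nu IH] mu /=.
  by rewrite eqb0 negbK => /eqP ->; rewrite big1 // => a _; rewrite ffunE.
rewrite -lt0n lt0n sum_nat_eq0 negb_forall => /existsP[a].
rewrite negb_imply => /andP[le /IH]; rewrite sum_dec // => <-.
by rewrite subnKC // (leq_trans le) // (bigD1 a) //= leq_addr.
Qed.

Lemma psumf_swap k l nu mu : psumf [:: k, l & nu] mu = psumf [:: l, k & nu] mu.
Proof.
(* The pairs (a, b) with x_a^i x_b^j dividing the monomial, the case a = b included: a form
   symmetric in the two parts. *)
have step i j : psumf [:: i, j & nu] mu =
    (\sum_a \sum_b if [forall c, i * (c == a) + j * (c == b) <= mu c]
       then psumf nu (dec (dec mu i a) j b) else 0)%N.
  rewrite /= big_mkcond; apply: eq_bigr => a _; case: ifP => [le|/negP nle].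
    rewrite big_mkcond; apply: eq_bigr => b _; congr (if _ then _ else _).
    apply/idP/forallP => [le2 c|/(_ b)]; rewrite ?ffunE ?eqxx; last by lia.
    move: le2; rewrite ffunE; have [->|_] := eqVneq c b.
      by have [->|_] := eqVneq b a; rewrite ?muln1 ?muln0; lia.
    by have [->|_] := eqVneq c a; rewrite ?muln1 ?muln0; lia.
  rewrite big1 // => b _; case: forallP => // /(_ a); rewrite eqxx muln1 => le.
  by case: nle; apply: leq_trans le; apply: leq_addr.
rewrite !step exchange_big; apply: eq_bigr => a _; apply: eq_bigr => b _.
have -> : dec (dec mu k b) l a = dec (dec mu l a) k b.
  by apply/ffunP => c; rewrite !ffunE -!subnDA addnC.
by congr (if _ then _ else _); apply: eq_forallb => c; rewrite addnC.
Qed.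

Lemma psumf_perm nu nu' mu : perm_eq nu nu' -> psumf nu mu = psumf nu' mu.
Proof.
have mv k s1 s2 m : psumf (s1 ++ k :: s2) m = psumf (k :: s1 ++ s2) m.
  elim: s1 m => [|l s1 IH] m //; rewrite [RHS]psumf_swap /=.
  by apply: eq_bigr => a _; rewrite IH.
elim: nu nu' mu => [|k nu IH] nu' mu e.
  by rewrite perm_sym in e; rewrite (perm_nilP e).
have kin : k \in nu' by rewrite -(perm_mem e) mem_head.
move: e; case/splitPr: kin => s1 s2 e; rewrite mv /=.
apply: eq_bigr => a _; apply: IH; rewrite -(perm_cons k).
by apply: perm_trans e _; rewrite -cat1s perm_catCA.
Qed.

(** This is p_(d nu)(x) = p_nu(x^d): only monomials that are d-th powers occur. *)
Lemma psumf_scale d nu mu : (0 < d)%N ->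
  psumf [seq (d * i)%N | i <- nu] mu =
  if [forall a, d %| mu a]%N then psumf nu [ffun a => mu a %/ d]%N else 0%N.
Proof.
move=> d0; elim: nu mu => [|k nu IH] mu /=.
  case: forallP => [dv|ndv].
    congr nat_of_bool; apply/eqP/eqP => [->|/ffunP e]; apply/ffunP => a.
      by rewrite !ffunE div0n.
    by have := e a; rewrite !ffunE -{2}(divnK (dv a)) => ->.
  by apply/eqP; rewrite eqb0; apply/eqP => e; case: ndv => a; rewrite e ffunE dvdn0.
case: forallP => [dv|ndv]; last first.
  rewrite big1 // => a le; rewrite IH; case: forallP => // dv; case: ndv => b.
  have := dv b; rewrite ffunE; have [->|_] := eqVneq b a; last by rewrite muln0 subn0.
  by rewrite muln1 => dv'; rewrite -(subnK le) dvdn_add // dvdn_mulr.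
apply: eq_big => [a|a le]; first by rewrite ffunE leq_divRL // mulnC.
rewrite IH; case: forallP => [_|[] b]; last first.
  by rewrite ffunE dvdn_sub // -mulnA dvdn_mulr.
congr psumf; apply/ffunP => b; rewrite !ffunE -mulnA.
by rewrite divnBr ?dvdn_mulr // mulKn.
Qed.

End PowerSums.

(** Removing one copy of [k] inverts the insertion of [k] followed by sorting. *)
Lemma perm_intparts_cons k n : (0 < k <= n)%N ->
  perm_eq [seq sort geq (k :: nu) | nu <- intparts (n - k)]
          [seq nu <- intparts n | k \in nu].
Proof.
case/andP=> k0 kn.
have geq_trans : transitive geq by move=> x y z; rewrite /geq /=; lia.
have geq_anti : antisymmetric geq by move=> x y; rewrite /geq /=; lia.
have geq_total : total geq by move=> x y; rewrite /geq /=; lia.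
apply: uniq_perm; last 1 first.
- move=> nu; rewrite mem_filter mem_intparts; apply/mapP/andP => [[nu']|[kin]].
    rewrite mem_intparts => /and3P[so nz /eqP sn] ->.
    rewrite mem_sort mem_head; split=> //; apply/and3P; split.
    - exact: sort_sorted.
    - by rewrite mem_sort inE negb_or nz eq_sym -lt0n k0.
    - have pm : perm_eq (sort geq (k :: nu')) (k :: nu') by rewrite perm_sort.
      by rewrite (perm_sumn pm) /= sn subnKC.
  case/and3P=> so nz /eqP sn; exists (rem k nu).
    have sub := rem_subseq k nu.
    rewrite mem_intparts; apply/and3P; split.
    - exact: subseq_sorted sub so.
    - by apply: contra nz; apply: (mem_subseq sub).
    - by have /perm_sumn := perm_to_rem kin; rewrite sn /= => ->; rewrite addKn.
  apply: (sorted_eq geq_trans geq_anti) => //; first exact: sort_sorted.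
  by rewrite perm_sym perm_sort perm_sym perm_to_rem.
- rewrite map_inj_in_uniq ?intparts_uniq // => x y.
  rewrite !mem_intparts => /and3P[sx _ _] /and3P[sy _ _] e.
  apply: (sorted_eq geq_trans geq_anti) => //; rewrite -(perm_cons k).
  by rewrite -(perm_sort geq) e perm_sort.
- by rewrite filter_uniq ?intparts_uniq.
Qed.

Lemma intparts0 : intparts 0 = [:: [::]].
Proof.
have e : perm_eq (intparts 0) [:: [::]].
  apply: uniq_perm; rewrite ?intparts_uniq // => nu; rewrite mem_intparts inE.
  apply/idP/eqP => [/and3P[_]|-> //]; case: nu => // x nu.
  by rewrite inE negb_or eq_sym /= => /andP[x0 _]; rewrite addn_eq0 (negbTE x0).
by apply: perm_small_eq.
Qed.

(* Both sides satisfy the Newton recursion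
   n E(mu) = \sum_k y_k \sum_(a | k <= mu a) E(mu - k a). *)
Lemma prod_coef_newton L (y c : nat -> {poly rat}) (mu : {ffun 'I_L -> nat}) :
  c 0%N = 1 ->
  (forall a, (a <= \sum_i mu i)%N ->
     a%:R * c a = \sum_(1 <= k < a.+1) y k * c (a - k)%N) ->
  \prod_i c (mu i) =
  \sum_(nu <- intparts (\sum_i mu i))
     ((zee nu)%:R^-1 : rat) *: ((\prod_(k <- nu) y k) * (psumf nu mu)%:R).
Proof.
move=> c0 crec; move en: (\sum_i mu i)%N => n.
rewrite en in crec; elim/ltn_ind: n mu en crec => n IH mu en crec.
case: n => [|n] in IH en crec *.
  rewrite intparts0 big_seq1 big_nil mul1r /=.
  have mu0 : mu = [ffun=> 0%N].
    apply/ffunP => a; rewrite ffunE; apply/eqP; rewrite -leqn0 -en.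
    by rewrite (bigD1 a) //= leq_addr.
  rewrite mu0 eqxx /zee big_nil invr1 scale1r big1 // => a _.
  by rewrite ffunE.
have n0 : (n.+1)%:R != 0 :> {poly rat} by rewrite -polyC_natr polyC_eq0 pnatr_eq0.
apply: (mulfI n0).
(* Writing n as the sum of the exponents, the recursion for [c] is applied to one factor c(mu a) at
   a time. *)
transitivity (\sum_(1 <= k < n.+2) y k *
    \sum_(a | (k <= mu a)%N) \prod_i c (dec mu k a i)).
  rewrite -[in LHS]en natr_sum mulr_suml.
  transitivity (\sum_(a : 'I_L) \sum_(1 <= k < n.+2)
     if (k <= mu a)%N then y k * \prod_i c (dec mu k a i) else 0).
    apply: eq_bigr => a _.
    have le : (mu a <= n.+1)%N by rewrite -en (bigD1 a) //= leq_addr.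
    rewrite (bigD1 a) //= mulrA crec // mulr_suml -big_mkcond /=.
    rewrite [RHS](big_cat_nat _ (n := (mu a).+1)) //=.
    rewrite [X in _ + X]big_nat_cond [X in _ + X]big1 ?addr0; last by move=> i; lia.
    rewrite big_nat_cond [in RHS]big_nat_cond; apply: eq_big => [k|k]; first by lia.
    move=> /andP[/andP[k1 k2] _]; rewrite -mulrA; congr (_ * _).
    rewrite [in RHS](bigD1 a) //= ffunE eqxx muln1; congr (_ * _).
    by apply: eq_bigr => b /negbTE ne; rewrite ffunE ne muln0 subn0.
  rewrite exchange_big /=; apply: eq_bigr => k _.
  by rewrite mulr_sumr [in RHS]big_mkcond.
(* By induction the inner product is a sum over partitions of n - k. Adding a part k to reach nu
   multiplies z by k m_k(nu), which is compensated by the weight here. *)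
transitivity (\sum_(1 <= k < n.+2) \sum_(nu <- intparts n.+1 | k \in nu)
   (k * count_mem k nu)%:R *
     (((zee nu)%:R^-1 : rat) *: ((\prod_(k <- nu) y k) * (psumf nu mu)%:R))).
  apply: eq_big_nat => k /andP[k0]; rewrite ltnS => kn.
  have pm := perm_intparts_cons (introT andP (conj k0 kn)).
  rewrite -[RHS]big_filter -[RHS](perm_big _ pm) /= big_map {pm}.
  transitivity (\sum_(nu <- intparts (n.+1 - k)) ((zee nu)%:R^-1 : rat) *:
     (y k * \prod_(i <- nu) y i * (psumf (k :: nu) mu)%:R)); last first.
    apply: eq_big_seq => nu; rewrite mem_intparts => /and3P[_ nz _].
    have pm : perm_eq (sort geq (k :: nu)) (k :: nu) by rewrite perm_sort.
    rewrite (psumf_perm _ pm) (zee_perm pm) (seq.permP pm) (perm_big _ pm) /= big_cons.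
    rewrite eqxx add1n zee_cons [RHS]mulr_natl -[RHS]scaler_nat scalerA; congr (_ *: _).
    rewrite [in RHS](natrM _ (k * _)%N) invfM mulrA divff ?mul1r //.
    by rewrite pnatr_eq0 -lt0n muln_gt0 k0.
  transitivity (\sum_(a | (k <= mu a)%N) \sum_(nu <- intparts (n.+1 - k))
     ((zee nu)%:R^-1 : rat) *: (y k * \prod_(i <- nu) y i * (psumf nu (dec mu k a))%:R)).
    rewrite mulr_sumr; apply: eq_bigr => a le.
    rewrite (IH (n.+1 - k)%N) ?sum_dec ?en //; first last.
    - by move=> b le'; apply: crec; lia.
    - by lia.
    by rewrite mulr_sumr; apply: eq_bigr => nu _; rewrite -scalerAr mulrA.
  rewrite exchange_big /=; apply: eq_bigr => nu _.
  by rewrite natr_sum mulr_sumr scaler_sumr.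
rewrite (exchange_big_dep xpredT) //= mulr_sumr.
apply: eq_big_seq => nu; rewrite mem_intparts => /and3P[_ nz /eqP sn].
(* For fixed nu the weights k m_k(nu), taken over the distinct parts, add up to n. *)
rewrite -mulr_suml -natr_sum; congr (_%:R * _).
rewrite -[RHS]sn sumnE -[RHS]big_undup_iterop_count.
rewrite -big_filter; apply: etrans (perm_big (undup nu) _) _.
  apply: uniq_perm; rewrite ?undup_uniq ?filter_uniq ?iota_uniq // => k.
  rewrite mem_filter mem_undup mem_index_iota; case: (boolP (k \in nu)) => // kin.
  have k0 : (0 < k)%N by rewrite lt0n; apply: contraNneq nz => <-.
  by rewrite k0 /= ltnS -sn mem_leq_sumn.
by apply: eq_bigr => k _; rewrite Monoid.iteropE iter_addn_0.
Qed.

(** * The polynomials G_nu *)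

Lemma coef_coprime_part k f j :
  (coprime_part k f)`_j = if coprime j k then f`_j else 0.
Proof.
rewrite coef_poly /coprime; case: ltnP => // le.
by rewrite nth_default // if_same.
Qed.

(** Multiplication by t^v shifts degrees by a multiple of k and so preserves their gcd with k. *)
Lemma coprime_partM k v f : (k %| v)%N ->
  coprime_part k (f * (1 - 'X^v)) = coprime_part k f * (1 - 'X^v).
Proof.
move=> kv; apply/polyP => j; rewrite !mulrBr !mulr1 coef_coprime_part !coefB !coefMXn.
rewrite !coef_coprime_part; case: ltnP => lt; first by rewrite !subr0.
suff -> : coprime (j - v) k = coprime j k by case: ifP; rewrite ?subr0.
case/dvdnP: kv lt => q -> lt.
by rewrite /coprime ![gcdn _ k]gcdnC -[in RHS](subnKC lt) gcdnMDl.
Qed.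

Lemma coprime_part_prod k (nu : seq nat) f : all (dvdn k) nu ->
  coprime_part k (f * \prod_(i <- nu) (1 - 'X^i)) =
  coprime_part k f * \prod_(i <- nu) (1 - 'X^i).
Proof.
elim: nu f => [|v nu IH] f; first by rewrite !big_nil !mulr1.
by case/andP=> kv /IH {}IH; rewrite !big_cons !mulrA IH coprime_partM.
Qed.

Lemma coef_sum_Xn M (P : pred nat) (a : nat -> rat) j :
  (\sum_(1 <= r < M | P r) a r *: 'X^r)`_j = if (0 < j < M)%N && P j then a j else 0.
Proof.
rewrite coefE -[LHS]big_filter.
have [/andP[jM Pj]|nj] := boolP ((0 < j < M)%N && P j).
  rewrite (perm_big [:: j]) ?big_seq1 //; apply: uniq_perm => //.
    by rewrite filter_uniq ?iota_uniq.
  move=> i; rewrite mem_filter mem_index_iota inE /=.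
  by have [->|] := eqVneq i j; rewrite ?andbF // Pj jM.
rewrite big_filter_cond big_nat_cond big1 // => i /and3P[iM].
by case/andP=> Pi /eqP ij _; case/negP: nj; rewrite -ij iM Pi.
Qed.

Lemma gcds_dvd (nu : seq nat) : all (dvdn (gcds nu)) nu.
Proof.
apply/allP => i ins; rewrite /gcds; elim: nu ins => //= k nu IH.
rewrite inE big_cons => /orP[/eqP ->|/IH]; first exact: dvdn_gcdl.
by apply: dvdn_trans; apply: dvdn_gcdr.
Qed.

Lemma dvdn_gcds d (nu : seq nat) : (d %| gcds nu)%N = all (dvdn d) nu.
Proof.
rewrite /gcds; elim: nu => [|k nu IH]; first by rewrite big_nil dvdn0.
by rewrite big_cons dvdn_gcd IH.
Qed.

Lemma gcds_scale d (nu : seq nat) :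
  gcds [seq (d * i)%N | i <- nu] = (d * gcds nu)%N.
Proof.
rewrite /gcds; elim: nu => [|k nu IH]; first by rewrite !big_nil muln0.
by rewrite /= !big_cons IH muln_gcdr.
Qed.

(** Each factor 1 - t in the denominator of the Eulerian series turns one [qint i] into 1 - t^i.
    Since g(nu) divides all parts, these factors pass through [coprime_part], which then only
    selects r. *)
Lemma Gpoly_series M (nu : seq nat) : nu != [::] ->
  eqm M (Gpoly nu)
    ((\sum_(1 <= r < M | coprime r (gcds nu)) (r%:R ^+ (size nu).-1) *: 'X^r) *
     \prod_(i <- nu) (1 - 'X^i)).
Proof.
move=> nu0; set g := gcds nu; set k := (size nu).-1.
have H : eqm M ('X * eulerian k * \prod_(i <- nu) qint i)
   ((\sum_(1 <= r < M) (r%:R ^+ k) *: 'X^r) * \prod_(i <- nu) (1 - 'X^i)).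
  have -> : \prod_(i <- nu) (1 - 'X^i) = (1 - 'X) ^+ k.+1 * \prod_(i <- nu) qint i.
    have -> : k.+1 = size nu by rewrite prednK // lt0n size_eq0.
    elim: (nu) => [|i s IH]; first by rewrite !big_nil expr0 mulr1.
    rewrite !big_cons IH exprS.
    have -> : 1 - 'X^i = (1 - 'X) * qint i :> {poly rat}.
      by rewrite -opprB subrX1 -mulNr opprB.
    by rewrite mulrACA.
  by rewrite mulrA; apply: eqmM => //; rewrite [X in eqm _ _ X]mulrC; apply: eulerian_series.
have -> : Gpoly nu = coprime_part g ('X * eulerian k * \prod_(i <- nu) qint i) by [].
have cp f1 f2 : eqm M f1 f2 -> eqm M (coprime_part g f1) (coprime_part g f2).
  by move=> e j lt; rewrite !coef_coprime_part e.
apply: eqm_trans (cp _ _ H) _; rewrite coprime_part_prod ?gcds_dvd //.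
apply: eqmM => // j lt; rewrite coef_coprime_part !coef_sum_Xn andbT.
by case: (coprime _ _); rewrite ?andbT ?andbF.
Qed.

Section Rpoly.

Variable L : nat.
Implicit Types mu : {ffun 'I_L -> nat}.

(** The factor n in front of the claimed coefficient stands for the choice of a starting point on an
    n-cycle; see [necklace_sum]. *)
Definition Rpoly n mu : {poly rat} :=
  n%:R * \sum_(nu <- intparts n) ((zee nu)%:R^-1 : rat) *: (Gpoly nu * (psumf nu mu)%:R).

(** By [Gpoly_series], n times the sum over nu and over r prime to g(nu) is [Rpoly]; allowing all r
    corresponds to allowing all words instead of primitive ones. *)
Definition Rterm mu r (nu : seq nat) : {poly rat} :=
  ((zee nu)%:R^-1 * r%:R ^+ (size nu).-1) *:
     ('X^r * (\prod_(i <- nu) (1 - 'X^i)) * (psumf nu mu)%:R).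

Lemma perm_intparts_scale d n : (0 < d)%N -> (d %| n)%N ->
  perm_eq [seq [seq (d * i)%N | i <- nu] | nu <- intparts (n %/ d)]
          [seq nu <- intparts n | all (dvdn d) nu].
Proof.
move=> d0 dn.
have mulI : injective (muln d) by move=> x y /eqP; rewrite eqn_pmul2l // => /eqP.
have so (s : seq nat) : sorted geq [seq (d * i)%N | i <- s] = sorted geq s.
  by rewrite sorted_map; apply: eq_sorted => x y /=; rewrite /geq /= leq_pmul2l.
have nz (s : seq nat) : (0%N \in [seq (d * i)%N | i <- s]) = (0%N \in s).
  by rewrite -[X in X \in map _ _](muln0 d) mem_map.
have sm (s : seq nat) : sumn [seq (d * i)%N | i <- s] = (d * sumn s)%N.
  by elim: s => [|x s IH] /=; rewrite ?muln0 // IH mulnDr.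
apply: uniq_perm.
- by rewrite map_inj_uniq ?intparts_uniq //; apply: inj_map.
- by rewrite filter_uniq ?intparts_uniq.
move=> nu; rewrite mem_filter; apply/mapP/andP => [[nu']|[/allP dv]].
  rewrite !mem_intparts => ip ->; split.
    by apply/allP => x /mapP[y _ ->]; rewrite dvdn_mulr.
  by rewrite /is_intpart so nz sm; case/and3P: ip => -> -> /eqP ->; rewrite mulnC divnK /=.
rewrite mem_intparts => ip.
have e : nu = [seq (d * i)%N | i <- [seq (i %/ d)%N | i <- nu]].
  rewrite -map_comp -[LHS]map_id; apply/eq_in_map => x /dv xd /=.
  by rewrite mulnC divnK.
exists [seq (i %/ d)%N | i <- nu] => //; rewrite mem_intparts.
move: ip; rewrite {1}e /is_intpart so nz sm => /and3P[-> -> /eqP <-] /=.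
by rewrite mulKn.
Qed.

(** If gcd(r, g(nu)) = d, dividing r and all k parts by d leaves a coprime pair. This changes z_nu
    by d^k and r^(k-1) by d^(k-1); the remaining factor 1/d turns n into n / d. *)
Lemma Rpoly_gcd_part M d n mu : (0 < d)%N -> (d %| n)%N -> (0 < n)%N ->
  eqm M (if [forall a, d %| mu a]%N
         then Rpoly (n %/ d) [ffun a => mu a %/ d]%N \Po 'X^d else 0)
    (n%:R * \sum_(nu <- intparts n)
       \sum_(1 <= r < M | d == gcdn r (gcds nu)) Rterm mu r nu).
Proof.
move=> d0 dn n0.
have -> : (if [forall a, d %| mu a]%N
         then Rpoly (n %/ d) [ffun a => mu a %/ d]%N \Po 'X^d else 0) =
   (n %/ d)%:R * \sum_(nu <- intparts (n %/ d))
     ((zee nu)%:R^-1 : rat) *: ((Gpoly nu \Po 'X^d) *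
        (psumf [seq (d * i)%N | i <- nu] mu)%:R).
  rewrite (eq_bigr (fun nu => if [forall a, d %| mu a]%N then
     ((zee nu)%:R^-1 : rat) *: ((Gpoly nu \Po 'X^d) *
        (psumf nu [ffun a => mu a %/ d]%N)%:R) else 0)); last first.
    by move=> nu _; rewrite psumf_scale //; case: ifP; rewrite ?mulr0 ?scaler0.
  case: ifP => _; last by rewrite big1 ?mulr0.
  rewrite /Rpoly rmorphM rmorph_nat rmorph_sum /=; congr (_ * _).
  by apply: eq_bigr => nu _; rewrite /= comp_polyZ rmorphM rmorph_nat.
have -> : \sum_(nu <- intparts n)
       \sum_(1 <= r < M | d == gcdn r (gcds nu)) Rterm mu r nu =
   \sum_(nu <- intparts (n %/ d)) \sum_(1 <= r < M | d == gcdn r (d * gcds nu))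
      Rterm mu r [seq (d * i)%N | i <- nu].
  rewrite (bigID (all (dvdn d))) /= [X in _ + X]big1 ?addr0; last first.
    move=> nu; rewrite -dvdn_gcds => nd; rewrite big1 // => r /eqP e.
    by case/negP: nd; rewrite e dvdn_gcdr.
  rewrite -big_filter -(perm_big _ (perm_intparts_scale d0 dn)) big_map.
  by apply: eq_bigr => nu _; rewrite gcds_scale.
rewrite !mulr_sumr big_seq_cond [X in eqm _ _ X]big_seq_cond.
apply: eqm_sum => nu; rewrite andbT mem_intparts => /and3P[_ nz /eqP sn].
have nu0 : nu != [::].
  apply: contraTneq n0 => nu0; rewrite nu0 /= in sn.
  by rewrite -(divnK dn) -sn mul0n.
set k := (size nu).-1.
have szE : size nu = k.+1 by rewrite prednK // lt0n size_eq0.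
have GE : eqm M (Gpoly nu \Po 'X^d) ((\sum_(1 <= r < M | d == gcdn r (d * gcds nu))
     ((r %/ d)%:R ^+ k) *: 'X^r) *
     \prod_(i <- [seq (d * i)%N | i <- nu]) (1 - 'X^i)).
  have GM := Gpoly_series (M := M) nu0; apply: eqm_trans (eqm_comp_Xn d0 GM) _.
  rewrite rmorphM /=; apply: eqmM; last first.
    rewrite rmorph_prod big_map; apply: eqm_prod => i _ j _ /=.
    by rewrite rmorphB rmorph1 /= comp_Xn_poly -exprM.
  move=> j lt; rewrite coef_comp_poly_Xn // (coef_sum_Xn _ _ (fun r => (r %/ d)%:R ^+ k)).
  rewrite (coef_sum_Xn _ _ (fun r => r%:R ^+ k)).
  case: (boolP (d %| j)%N) => [dj|ndj]; last first.
    by case: ifP => // /andP[_ /eqP e]; case/negP: ndj; rewrite e dvdn_gcdl.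
  congr (if _ then _ else _).
  have jE := divnK dj; rewrite -[in RHS]jE [in RHS]mulnC -muln_gcdr.
  rewrite -[X in _ = _ && (X == _)]muln1 eqn_pmul2l // [_ == gcdn _ _]eq_sym.
  have -> : (0 < d * (j %/ d) < M)%N = (0 < j %/ d)%N.
    by rewrite muln_gt0 d0 /= mulnC jE lt andbT.
  by rewrite (leq_ltn_trans (leq_div j d) lt) andbT.
apply: eqm_trans (eqmM (eqm_refl _) (eqmZ _ (eqmM GE (eqm_refl _)))) _.
rewrite !mulr_suml scaler_sumr !mulr_sumr; apply: eqm_sum => r /eqP dE j _.
have dr : (d %| r)%N by rewrite {1}dE dvdn_gcdl.
rewrite /Rterm size_map zee_scale // -!scalerAl -!scalerAr !scalerA.
rewrite !mulr_natl -!scaler_nat !scalerA; congr (polyseq (_ *: _))`_j.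
have dQ : d%:R != 0 :> rat by rewrite pnatr_eq0 -lt0n.
have zQ : (zee nu)%:R != 0 :> rat by rewrite pnatr_eq0 -lt0n zee_gt0.
rewrite -/k szE -[in RHS](divnK dn) -[in RHS](divnK dr) !natrM natrX exprMn exprS.
by field; rewrite zQ dQ expf_neq0.
Qed.

(** The pairs (r, nu) are sorted by gcd(r, g(nu)), which is a divisor of n. *)
Lemma Rpoly_sum M n mu : (0 < n)%N ->
  eqm M (\sum_(d <- divisors n) if [forall a, d %| mu a]%N
         then Rpoly (n %/ d) [ffun a => mu a %/ d]%N \Po 'X^d else 0)
    (n%:R * \sum_(1 <= r < M) \sum_(nu <- intparts n) Rterm mu r nu).
Proof.
move=> n0.
have -> : \sum_(1 <= r < M) \sum_(nu <- intparts n) Rterm mu r nu =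
  \sum_(d <- divisors n) \sum_(nu <- intparts n)
       \sum_(1 <= r < M | d == gcdn r (gcds nu)) Rterm mu r nu.
  rewrite [RHS]exchange_big [LHS]exchange_big /=; apply: eq_big_seq => nu.
  rewrite mem_intparts => /and3P[_ _ /eqP sn].
  rewrite (exchange_big_dep xpredT) //=; apply: eq_bigr => r _.
  rewrite -big_filter (perm_big [:: gcdn r (gcds nu)]) ?big_seq1 //.
  apply: uniq_perm; rewrite ?filter_uniq ?divisors_uniq // => d.
  rewrite mem_filter inE; case: eqP => // ->; rewrite -dvdn_divisors // -sn.
  apply: dvdn_trans (dvdn_gcdr _ _) _; rewrite sumnE big_seq.
  by apply: dvdn_sum => i; apply: (allP (gcds_dvd nu)).
rewrite mulr_sumr big_seq [X in eqm _ _ X]big_seq; apply: eqm_sum => d.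
rewrite -dvdn_divisors // => dn; apply: Rpoly_gcd_part => //.
exact: dvdn_gt0 dn.
Qed.

End Rpoly.

(** * Cyclic words *)

Section CyclicIndices.

Variable N : nat.

Lemma inZpD x y : inZp (x + y) = inZp x + inZp y :> 'I_N.+1.
Proof. by apply: val_inj; rewrite /= modnDm. Qed.

(** Positions form the group Z/(N+1). The step [inZp 1] also makes sense for N = 0, where it is
    0. *)
Definition nxt (p : 'I_N.+1) : 'I_N.+1 := p + inZp 1.

Lemma nxt_inZp x : nxt (inZp x) = inZp x.+1.
Proof. by rewrite /nxt -inZpD addn1. Qed.

Lemma inZp_per x : inZp (x + N.+1) = inZp x :> 'I_N.+1.
Proof. by apply: val_inj; rewrite /= modnDr. Qed.

End CyclicIndices.

Lemma sum_inZp N K d (F : 'I_K.+1 -> nat) : (N.+1 = d * K.+1)%N ->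
  (\sum_(p < N.+1) F (inZp p) = d * \sum_q F q)%N.
Proof.
move=> e; rewrite -(big_mkord xpredT (fun i => F (inZp i))) e big_nat_mul /=.
rewrite -[in RHS](card_ord d) -sum_nat_const -(big_mkord xpredT (fun=> \sum_q F q)%N).
apply: eq_bigr => i _; rewrite mulSn -{1}[(i * _)%N]add0n big_addn addnK big_mkord.
apply: eq_bigr => q _; congr F; apply: val_inj => /=.
by rewrite addnC modnMDl modn_small.
Qed.

Section Words.

Variable L : nat.

(* A letter, barred when its first component is [true].  Its second component is
   0 for the largest letter, 1 for the next one, and so on; see [rcont]. *)
Local Notation A := (bool * 'I_L)%type.

Definition ok (x y : A) : bool := if x.1 then (x.2 <= y.2)%N else (y.2 <= x.2)%N.

Section WordDefs.

Variable N : nat.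
Implicit Types w : {ffun 'I_N.+1 -> A}.

Definition good w := [forall p, ok (w p) (w (nxt p))].

Definition cont w : {ffun 'I_L -> nat} := [ffun a => \sum_p ((w p).2 == a)]%N.

Definition bars w := (\sum_p (w p).1)%N.

Definition period w e := [forall p, w (p + inZp e) == w p].

(** Testing the divisors of the length is enough: by [period_gcd], the gcd of a period with the
    length is again a period. *)
Definition prim w := all (fun e => (e < N.+1)%N ==> ~~ period w e) (divisors N.+1).

Lemma goodP w : reflect (forall x, ok (w (inZp x)) (w (inZp x.+1))) (good w).
Proof.
apply: (iffP forallP) => [h x|h p]; first by rewrite -nxt_inZp.
by have := h p; rewrite -nxt_inZp valZpK.
Qed.

Lemma periodP w e : reflect (forall x, w (inZp (x + e)) = w (inZp x)) (period w e).
Proof.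
apply: (iffP forallP) => [h x|h p]; first by apply/eqP; rewrite inZpD.
by have /eqP := h p; rewrite inZpD valZpK.
Qed.

Lemma period_size w : period w N.+1.
Proof. by apply/periodP => x; rewrite inZp_per. Qed.

Lemma period_mul w e k : period w e -> period w (k * e)%N.
Proof.
move/periodP => h; apply/periodP; elim: k => [|k IH] x; first by rewrite addn0.
by rewrite mulSn addnA IH h.
Qed.

(** Bezout: a shift by the gcd followed by a multiple of [e] is a multiple of [d]. *)
Lemma period_gcd w d e : (0 < d)%N -> period w d -> period w e -> period w (gcdn d e).
Proof.
move=> d0 pd pe; case: (egcdnP e d0) => km kn eq _.
have /periodP hd := period_mul km pd; have /periodP he := period_mul kn pe.
by apply/periodP => x; rewrite -he -addnA [(gcdn _ _ + _)%N]addnC -eq hd.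
Qed.

Definition Ppoly mu : {poly rat} :=
  \sum_(w | [&& good w, prim w & cont w == mu]) 'X^(bars w).

Definition Wpoly mu : {poly rat} :=
  \sum_(w | good w && (cont w == mu)) 'X^(bars w).

End WordDefs.

Section Repeat.

Variables (N K d : nat).
Hypothesis NE : (N.+1 = d * K.+1)%N.
Implicit Type u : {ffun 'I_K.+1 -> A}.

Definition rep u : {ffun 'I_N.+1 -> A} := [ffun p => u (inZp (val p))].

Lemma rep_inZp u x : rep u (inZp x) = u (inZp x).
Proof. by rewrite ffunE /=; congr (u _); apply: val_inj; rewrite /= modn_dvdm // NE dvdn_mull. Qed.

Lemma good_rep u : good (rep u) = good u.
Proof. by apply/goodP/goodP => h x; have := h x; rewrite !rep_inZp. Qed.

Lemma period_rep u e : period (rep u) e = period u e.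
Proof. by apply/periodP/periodP => h x; have := h x; rewrite !rep_inZp. Qed.

Lemma bars_rep u : bars (rep u) = (d * bars u)%N.
Proof.
rewrite /bars -(sum_inZp (fun p => (u p).1 : nat) NE); apply: eq_bigr => p _.
by rewrite ffunE.
Qed.

Lemma cont_rep u a : cont (rep u) a = (d * cont u a)%N.
Proof.
rewrite !ffunE -(sum_inZp (fun p => (u p).2 == a : nat) NE).
by apply: eq_bigr => p _; rewrite ffunE.
Qed.

End Repeat.

Definition minper N (w : {ffun 'I_N.+1 -> A}) e :=
  period w e && all (fun e' => (e' < e)%N ==> ~~ period w e') (divisors N.+1).

(** The one divisor counted is the length divided by the least period; this allows words to be
    sorted by their exponent as powers of primitive words. *)
Lemma minper_count N (w : {ffun 'I_N.+1 -> A}) :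
  count (fun d => minper w (N.+1 %/ d)) (divisors N.+1) = 1%N.
Proof.
have ex : exists e, (e \in divisors N.+1) && period w e.
  by exists N.+1; rewrite -dvdn_divisors // dvdnn period_size.
case: (ex_minnP ex) => e0; rewrite -dvdn_divisors // => /andP[e0n pe0] emin.
have e00 : (0 < e0)%N by apply: dvdn_gt0 e0n.
rewrite -(@eq_in_count _ (pred1 (N.+1 %/ e0)%N)); last first.
  move=> d; rewrite -dvdn_divisors // => dn /=.
  have d0 : (0 < d)%N by apply: dvdn_gt0 dn.
  apply/eqP/andP => [->|[pd /allP am]].
    rewrite divnA // mulKn //; split=> //; apply/allP => e en.
    apply/implyP => lt; apply/negP => pe.
    by have := emin e; rewrite en pe leqNgt lt => /(_ isT).
  have : (e0 = N.+1 %/ d)%N.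
    apply/eqP; rewrite eqn_leq emin ?pd -?dvdn_divisors ?dvdn_div //=.
    rewrite leqNgt; apply/negP => lt.
    have := am e0; rewrite -dvdn_divisors // lt pe0 => /(_ e0n).
    by [].
  by move=> ->; rewrite divnA // mulKn.
by rewrite count_uniq_mem ?divisors_uniq // -dvdn_divisors // dvdn_div.
Qed.

(** A word is the d-th power of a unique primitive word for a unique d, and taking the power
    multiplies the exponents and the number of bars by d. *)
Lemma Wpoly_prim N mu :
  Wpoly N mu = \sum_(d <- divisors N.+1) if [forall a, d %| mu a]%N
     then Ppoly (N.+1 %/ d).-1 [ffun a => mu a %/ d]%N \Po 'X^d else 0.
Proof.
have -> : Wpoly N mu = \sum_(d <- divisors N.+1)
    \sum_(w : {ffun 'I_N.+1 -> A} | [&& good w, cont w == mu & minper w (N.+1 %/ d)])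
      'X^(bars w).
  rewrite (exchange_big_dep (fun w => good w && (cont w == mu))) /=; last first.
    by move=> d w _ /and3P[-> ->].
  apply: eq_bigr => w gw; rewrite -big_filter big_const_seq.
  rewrite (eq_count (a2 := predT)) // count_predT size_filter.
  rewrite (eq_count (a2 := fun d => minper w (N.+1 %/ d))); last first.
    by move=> d; rewrite /= andbA gw.
  by rewrite minper_count /= addr0.
apply: eq_big_seq => d; rewrite -dvdn_divisors // => dn.
have d0 : (0 < d)%N by apply: dvdn_gt0 dn.
set K := (N.+1 %/ d).-1.
have KE : K.+1 = (N.+1 %/ d)%N by rewrite prednK // divn_gt0 // dvdn_leq.
have NE : (N.+1 = d * K.+1)%N by rewrite KE mulnC divnK.
rewrite -KE.
pose res (w : {ffun 'I_N.+1 -> A}) : {ffun 'I_K.+1 -> A} := [ffun q => w (inZp (val q))].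
rewrite (reindex_onto (@rep N K) res) /=; last first.
  move=> w /and3P[_ _ /andP[/periodP pw _]]; apply/ffunP => p.
  have pm := period_mul (p %/ K.+1) (introT (periodP _ _) pw).
  rewrite -[p]valZpK (rep_inZp NE) ffunE -(periodP _ _ pm).
  by congr (w _); apply: val_inj; rewrite /= addnC -divn_eq.
have eq1 u : [&& good (rep N u), cont (rep N u) == mu & minper (rep N u) K.+1]
      && (res (rep N u) == u) =
   [forall a, d %| mu a]%N && [&& good u, prim u & cont u == [ffun a => mu a %/ d]%N].
  have -> : res (rep N u) == u.
    apply/eqP/ffunP => q; rewrite ffunE (rep_inZp NE) valZpK //.
  rewrite (good_rep NE) andbT [RHS]andbCA; congr andb.
  have -> : minper (rep N u) K.+1 = prim u.
    rewrite /minper (period_rep NE) period_size /=; apply/allP/allP => h e en.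
      rewrite -(period_rep NE); apply: h; move: en; rewrite -!dvdn_divisors //.
      by move=> en; rewrite NE dvdn_mull.
    (* A divisor of N.+1 need not divide K.+1, so the period is replaced by its gcd with K.+1. *)
    apply/implyP => lt; rewrite (period_rep NE); apply/negP => pe.
    have e0 : (0 < e)%N by move: en; rewrite -dvdn_divisors //; apply: dvdn_gt0.
    have pg := period_gcd e0 pe (period_size u).
    have := h (gcdn e K.+1); rewrite -dvdn_divisors // dvdn_gcdr pg => /(_ isT).
    by rewrite (leq_ltn_trans _ lt) // dvdn_leq // dvdn_gcdl.
  rewrite [RHS]andbCA [LHS]andbC; congr andb.
  apply/eqP/andP => [<-|[/forallP dv /eqP ce]].
    split; first by apply/forallP => a; rewrite (cont_rep NE) dvdn_mulr.
    by apply/eqP/ffunP => a; rewrite [RHS]ffunE (cont_rep NE) mulKn.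
  by apply/ffunP => a; rewrite (cont_rep NE) ce ffunE mulnC divnK.
rewrite (eq_bigl _ _ eq1); case: ifP => [dv|ndv] /=; last by rewrite big_pred0.
rewrite /Ppoly rmorph_sum /=; apply: eq_bigr => u _.
by rewrite (bars_rep NE) comp_Xn_poly exprM.
Qed.

End Words.

(** * Words with separators *)

Section Gaps.

Variables (L N : nat).
Implicit Types (w : {ffun 'I_N.+1 -> 'I_L}) (mu : {ffun 'I_L -> nat}).

Definition vcont w : {ffun 'I_L -> nat} := [ffun a => \sum_p (w p == a)]%N.

Definition gapw (a a' : 'I_L) : {poly rat} := (a <= a')%N%:R * 'X + (a' <= a)%N%:R.

(** Once the values are fixed, whether a bar is allowed at p depends only on the values at p and the
    next position, so the bars are chosen independently. *)
Lemma Wpoly_gapw mu :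
  Wpoly N mu = \sum_(w | vcont w == mu) \prod_p gapw (w p) (w (nxt p)).
Proof.
pose F (k : {ffun 'I_N.+1 -> bool * 'I_L}) : {poly rat} :=
  \prod_p ((ok (k p) (k (nxt p)))%:R * 'X^((k p).1)).
have FE k : F k = if good k then 'X^(bars k) else 0.
  rewrite /F; case: ifP => [/forallP gk|/negbT]; last first.
    by rewrite negb_forall => /existsP[p /negbTE e]; rewrite (bigD1 p) //= e !mul0r.
  rewrite /bars; under eq_bigr => p _ do rewrite gk mul1r.
  by elim/big_rec2: _ => // p x y _ ->; rewrite exprD.
pose h (wc : {ffun 'I_N.+1 -> 'I_L} * {ffun 'I_N.+1 -> bool}) :
  {ffun 'I_N.+1 -> bool * 'I_L} := [ffun p => (wc.2 p, wc.1 p)].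
have hbij : bijective h.
  exists (fun k : {ffun 'I_N.+1 -> bool * 'I_L} =>
    ([ffun p => (k p).2], [ffun p => (k p).1])) => [[w c]|k].
    by congr pair; apply/ffunP => p; rewrite !ffunE.
  by apply/ffunP => p; rewrite !ffunE /=; case: (k p).
have -> : Wpoly N mu = \sum_(k | cont k == mu) F k.
  rewrite /Wpoly [LHS]big_mkcond [RHS]big_mkcond; apply: eq_bigr => k _.
  by rewrite FE; case: good; case: eqP.
rewrite (reindex h) /=; last exact: onW_bij.
have contE wc : cont (h wc) = vcont wc.1.
  by apply/ffunP => a; rewrite !ffunE; apply: eq_bigr => p _; rewrite ffunE.
rewrite (eq_bigl (fun wc => vcont wc.1 == mu)); last by move=> wc; rewrite contE.
transitivity (\sum_(w | vcont w == mu) \sum_c F (h (w, c))).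
  by rewrite pair_big /=; apply: eq_big => [[w c]|[w c] _] //=; rewrite andbT.
apply: eq_bigr => w _.
pose G p (b : bool) : {poly rat} :=
  (if b then (w p <= w (nxt p))%N else (w (nxt p) <= w p)%N)%:R * 'X^b.
transitivity (\prod_p \sum_(b : bool) G p b).
  rewrite bigA_distr_bigA; apply: eq_bigr => c _; apply: eq_bigr => p _.
  by rewrite !ffunE.
apply: eq_bigr => p _; rewrite big_bool /G expr1 expr0 mulr1.
by [].
Qed.

(** The terms with b > 0 form a geometric series with sum t; the value at b = 0 completes it to 1 +
    t, t or 1 for a = a', a < a' or a > a'. *)
Definition gapb (b : nat) (a a' : 'I_L) : {poly rat} :=
  if b == 0%N then (if a == a' then 1 else if (a < a')%N then 0 else 1 - 'X)
  else 1 - 'X.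

Lemma gapw_series M a a' : eqm M (gapw a a') (\sum_(b < M) 'X^b * gapb b a a').
Proof.
case: M => [//|M]; apply: eqm_sym.
have -> : \sum_(b < M.+1) 'X^b * gapb b a a' =
    (1 - 'X) * \sum_(b < M.+1) 'X^b + (gapb 0 a a' - (1 - 'X)).
  rewrite big_ord_recl [in RHS]big_ord_recl /= expr0 mul1r mulrDr mulr1.
  rewrite mulr_sumr [X in _ = _ + X + _](eq_bigr (fun i : 'I_M =>
    'X^(bump 0 i) * gapb (bump 0 i) a a')).
    by ring.
  by move=> i _; rewrite mulrC.
apply: eqm_trans (eqmD (@eqm_geom _ _) (eqm_refl _)) _.
have -> : 1 + (gapb 0 a a' - (1 - 'X)) = gapw a a'.
  rewrite /gapw /gapb /=; have [->|ne] := eqVneq a a'; first by rewrite leqnn /=; ring.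
  have {}ne : (a : nat) != a' by [].
  by case: ltngtP ne => //= _ _; ring.
by [].
Qed.

(** The part with r separators in total. The bound M on a single gap excludes nothing when r < M. *)
Definition gapT M r mu : {poly rat} :=
  \sum_(w | vcont w == mu) \sum_(b : {ffun 'I_N.+1 -> 'I_M} | (\sum_p b p == r)%N)
     \prod_p gapb (b p) (w p) (w (nxt p)).

Lemma Wpoly_series M mu : eqm M (Wpoly N mu) (\sum_(r < M) 'X^r * gapT M r mu).
Proof.
rewrite Wpoly_gapw.
have -> : \sum_(r < M) 'X^r * gapT M r mu = \sum_(w | vcont w == mu) \sum_(r < M)
    \sum_(b : {ffun 'I_N.+1 -> 'I_M} | (\sum_p b p == r)%N)
       'X^r * \prod_p gapb (b p) (w p) (w (nxt p)).
  rewrite [RHS]exchange_big; apply: eq_bigr => r _.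
  by rewrite mulr_sumr; apply: eq_bigr => w _; rewrite mulr_sumr.
apply: eqm_sum => w _.
apply: (@eqm_trans _ _ (\prod_p \sum_(b < M) 'X^b * gapb b (w p) (w (nxt p)))).
  by apply: eqm_prod => p _; apply: gapw_series.
rewrite bigA_distr_bigA (eq_bigr _ (fun b _ => big_split _ _ _ _ _)) /=.
have XE (b : {ffun 'I_N.+1 -> 'I_M}) : \prod_p 'X^(b p) = 'X^(\sum_p b p) :> {poly rat}.
  by elim/big_rec2: _ => [//|p x y _ ->]; rewrite exprD.
(* Choices with M or more separators in total vanish modulo t^M. *)
rewrite (bigID (fun b : {ffun 'I_N.+1 -> 'I_M} => (\sum_p b p < M)%N)) /=.
rewrite -[X in eqm _ _ X]addr0; apply: eqmD; last first.
  move=> j lt; rewrite coef_sum coef0 big1 // => b; rewrite -leqNgt XE => le.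
  by rewrite (eqm_Xn0 _ le) // coef0.
case: M XE => [|M] XE; first by [].
rewrite (partition_big (fun b : {ffun 'I_N.+1 -> 'I_M.+1} =>
  inord (\sum_p b p) : 'I_M.+1) xpredT) //=.
apply: eqm_sum => r _ j _; congr (polyseq _)`_j.
apply: eq_big => [b|b /andP[lt /eqP <-]]; last by rewrite XE inordK.
apply/andP/eqP => [[lt /eqP <-]|e]; first by rewrite inordK.
by rewrite e ltn_ord inord_val.
Qed.

(** Without separators the weight vanishes as soon as an index rises, and an index that never rises
    around a cycle is constant. The constant words give the power sum p_n. *)
Lemma gapT0 M mu : (0 < M)%N -> (\sum_a mu a = N.+1)%N ->
  gapT M 0 mu = [forall a, N.+1 %| mu a]%N%:R.
Proof.
case: M => // M _ smu.
pose cst a : {ffun 'I_N.+1 -> 'I_L} := [ffun=> a].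
have cst_inj : injective cst by move=> a a' /ffunP/(_ ord0); rewrite !ffunE.
have cstE a b : vcont (cst a) b = (N.+1 * (a == b))%N.
  rewrite ffunE (eq_bigr (fun=> (a == b) : nat)) => [|p _]; last by rewrite ffunE.
  by rewrite sum_nat_const card_ord.
have prodE w : \prod_p gapb 0 (w p) (w (nxt p)) = (w == cst (w ord0))%:R.
  have [->|nw] := eqVneq w (cst (w ord0)).
    by rewrite big1 // => p _; rewrite !ffunE /gapb !eqxx.
  have [/existsP[p lt]|] := boolP [exists p, w p < w (nxt p)]%N.
    by rewrite (bigD1 p) //= /gapb /= lt -(inj_eq val_inj) ltn_eqF // mul0r.
  rewrite negb_exists => /forallP le; case/negP: nw.
  have le1 x : (w (inZp x.+1) <= w (inZp x))%N.
    by have := le (inZp x); rewrite -leqNgt nxt_inZp.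
  have le2 x y : (w (inZp (x + y)) <= w (inZp x))%N.
    by elim: y => [|y IH]; rewrite ?addn0 // addnS (leq_trans (le1 _)).
  apply/eqP/ffunP => p; rewrite ffunE; apply: val_inj; apply/eqP => /=.
  have z0 : inZp 0 = ord0 :> 'I_N.+1 by apply: val_inj; rewrite /= mod0n.
  have := le2 0%N p; rewrite add0n valZpK z0 => le3.
  have := le2 p (N.+1 - p)%N; rewrite subnKC ?(ltnW (ltn_ord p)) // valZpK.
  have -> : inZp N.+1 = ord0 :> 'I_N.+1 by rewrite -z0 -[RHS]inZp_per.
  by move=> le4; rewrite eqn_leq le3.
transitivity (\sum_a (vcont (cst a) == mu)%:R : {poly rat}).
  rewrite /gapT.
  transitivity (\sum_(w | vcont w == mu) (w == cst (w ord0))%:R : {poly rat}).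
    apply: eq_bigr => w _; rewrite (big_pred1 [ffun=> ord0]) => [|b].
      by rewrite -prodE; apply: eq_bigr => p _; rewrite ffunE.
    rewrite sum_nat_eq0; apply/forallP/eqP => [b0|-> p]; last by rewrite ffunE.
    by apply/ffunP => p; rewrite ffunE; apply/val_inj/eqP; have := b0 p.
  transitivity (\sum_(w | (vcont w == mu) && (w == cst (w ord0))) 1 : {poly rat}).
    by rewrite big_mkcondr; apply: eq_bigr => w _; case: eqP.
  rewrite (reindex_onto cst (fun w => w ord0)) => [|w /andP[_ /eqP <-]] //.
  rewrite big_mkcond; apply: eq_bigr => a _.
  by rewrite ffunE !eqxx !andbT; case: eqP.
case: forallP => [dv|ndv]; last first.
  rewrite big1 // => a _; case: eqP => // e; case: ndv => b.
  by rewrite -e cstE dvdn_mulr.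
have [a mua] : exists a, (0 < mu a)%N.
  apply/existsP; apply: contraT; rewrite negb_exists => /forallP h.
  move: smu; rewrite big1 // => a _; apply/eqP; rewrite -leqn0 leqNgt; exact: h.
have muN : mu a = N.+1.
  apply/eqP; rewrite eqn_leq (dvdn_leq mua (dv a)) andbT.
  by rewrite -smu (bigD1 a) //= leq_addr.
have mu0 b : b != a -> mu b = 0%N.
  move=> ba; move: smu; rewrite (bigD1 a) //= muN (bigD1 b) //=; lia.
have muE : mu = vcont (cst a).
  apply/ffunP => b; rewrite cstE eq_sym; have [->|/mu0 ->] := eqVneq b a.
    by rewrite muN muln1.
  by rewrite muln0.
rewrite (bigD1 a) //= big1 ?addr0 ?muE ?eqxx // => b ba.
case: eqP => // /ffunP/(_ a); rewrite !cstE (negbTE ba) eqxx; lia.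
Qed.

(** The factor [b ord_max] counts the ways to mark a separator in the last gap, where the word is
    going to be cut. *)
Definition gapU M r mu : {poly rat} :=
  \sum_(w | vcont w == mu) \sum_(b : {ffun 'I_N.+1 -> 'I_M} | (\sum_p b p == r)%N)
     (b ord_max)%:R * \prod_p gapb (b p) (w p) (w (nxt p)).

(* Rotations bring any of the r separators into the last gap. *)
Lemma gapTU M r mu : r%:R * gapT M r mu = N.+1%:R * gapU M r mu.
Proof.
pose rot T s (f : {ffun 'I_N.+1 -> T}) : {ffun 'I_N.+1 -> T} := [ffun x => f (x + s)].
have rot_bij (T : Type) s : bijective (@rot T s).
  by exists (@rot T (- s)) => f; apply/ffunP => x; rewrite !ffunE ?addrNK ?addrK.
pose Up p := \sum_(w | vcont w == mu)
   \sum_(b : {ffun 'I_N.+1 -> 'I_M} | (\sum_p b p == r)%N)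
     (b p)%:R * \prod_p gapb (b p) (w p) (w (nxt p)).
transitivity (\sum_p Up p).
  rewrite /Up /gapT [RHS]exchange_big mulr_sumr; apply: eq_bigr => w _.
  rewrite [RHS]exchange_big mulr_sumr; apply: eq_bigr => b /eqP <-.
  by rewrite natr_sum mulr_suml.
rewrite mulr_natl -[X in _ *+ X](card_ord N.+1) -sumr_const; apply: eq_bigr => p _.
pose s := ord_max - p.
rewrite /Up (reindex (rot _ s)) /=; last exact: onW_bij.
apply: eq_big => [w|w _].
  congr (_ == _); apply/ffunP => a; rewrite !ffunE.
  rewrite [RHS](reindex_inj (addIr s)); apply: eq_bigr => x _.
  by rewrite ffunE.
rewrite (reindex (rot _ s)) /=; last exact: onW_bij.
apply: eq_big => [b|b _].
  congr (_ == _); rewrite [RHS](reindex_inj (addIr s)); apply: eq_bigr => x _.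
  by rewrite ffunE.
rewrite ffunE /s addrC subrK; congr (_ * _).
rewrite [RHS](reindex_inj (addIr (ord_max - p))); apply: eq_bigr => x _.
by rewrite !ffunE /nxt addrAC.
Qed.

End Gaps.

(** * Sorted words and multisets *)

Section SortedWords.

Variables (R : comNzRingType) (z : R) (T : finType) (le : rel T).
Hypotheses (le_total : total le) (le_anti : antisymmetric le) (le_trans : transitive le).

(** For z = 1 - t these are the coefficients of (1 - t y) / (1 - y) as a series in y. *)
Definition wt0 (k : nat) : R := if k == 0%N then 1 else z.

Definition adj (x y : T) : R := if x == y then 1 else if le x y then z else 0.

(** Equal entries of a sorted word are adjacent, so every change of entry starts a new value and
    yields a factor z; the leading z belongs to the first value. *)
Lemma path_weight x s :
  z * \prod_(i < size s) adj (nth x (x :: s) i) (nth x s i) =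
  if path le x s then \prod_c wt0 (count_mem c (x :: s)) else 0.
Proof.
have le_refl y : le y y by case/orP: (le_total y y).
elim: s x => [|y s IH] x.
  rewrite big_ord0 mulr1 /= (bigD1 x) //= eqxx big1 ?mulr1 // => c ne.
  by rewrite eq_sym (negbTE ne).
have nthE : \prod_(i < size s)
      adj (nth x [:: x, y & s] (lift ord0 i)) (nth x (y :: s) (lift ord0 i)) =
    \prod_(i < size s) adj (nth y (y :: s) i) (nth y s i).
  apply: eq_bigr => i _; rewrite /=; congr adj; apply: set_nth_default => /=;
    by rewrite add0n ?ltnS ?(ltnW (ltn_ord i)) ?ltn_ord.
rewrite /= big_ord_recl /= nthE mulrCA IH /=; rewrite /adj.
have [->|ne] := eqVneq x y.
  rewrite le_refl mul1r; case: ifP => // _.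
  by apply: eq_bigr => c _; case: (y == c).
case: ifP => lexy; last by rewrite mul0r.
case: ifP => [pys|_]; last by rewrite mulr0.
have xn : x \notin y :: s.
  rewrite inE negb_or ne; apply/negP => xs.
  have /allP/(_ _ xs) := order_path_min le_trans pys.
  by move=> leyx; case/eqP: ne; apply: le_anti; rewrite lexy.
rewrite (bigD1 x) //= [in RHS](bigD1 x) //= eqxx /wt0 /= mulrA.
have /count_memPn /= -> := xn; rewrite mulr1; congr (_ * _).
by apply: eq_bigr => c nc; rewrite [x == c]eq_sym (negbTE nc).
Qed.

(** A sorted word is determined by its multiplicities, and all multiplicities of total n occur. *)
Lemma sum_sorted_tuples n (P : pred {ffun T -> nat}) :
  \sum_(t : n.-tuple T | sorted le t && P [ffun c => count_mem c t])
     \prod_c wt0 (count_mem c t) =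
  \sum_(e : {ffun T -> 'I_n.+1} | (\sum_c e c == n)%N && P [ffun c => val (e c)])
     \prod_c wt0 (e c).
Proof.
pose cnt (t : n.-tuple T) : {ffun T -> 'I_n.+1} := [ffun c => inord (count_mem c t)].
have cntE t c : cnt t c = count_mem c t :> nat.
  by rewrite ffunE inordK // ltnS -[X in (_ <= X)%N](size_tuple t) count_size.
have sum_cnt (s : seq T) : (\sum_c count_mem c s = size s)%N.
  elim: s => [|x s IH] /=; first by rewrite big1.
  rewrite big_split /= IH (bigD1 x) //= eqxx big1 ?addn0 // => c ne.
  by rewrite eq_sym (negbTE ne).
rewrite (partition_big cnt (fun e => (\sum_c e c == n)%N && P [ffun c => val (e c)])) /=.
  apply: eq_bigr => e /andP[/eqP se Pe].
  pose s0 := flatten [seq nseq (e c) c | c <- enum T].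
  have s0c c : count_mem c s0 = e c.
    rewrite count_flatten -map_comp sumnE big_map big_enum /= (bigD1 c) //=.
    rewrite count_nseq /= eqxx mul1n big1 ?addn0 // => d ne.
    by rewrite count_nseq /= (negbTE ne).
  have s0n : size (sort le s0) == n.
    by rewrite size_sort -sum_cnt -[X in _ == X]se; apply/eqP/eq_bigr => c _.
  have sc c : count_mem c (sort le s0) = e c.
    by rewrite -s0c; apply/seq.permP; rewrite perm_sort.
  rewrite (big_pred1 (Tuple s0n)) => [|t].
    by apply: eq_bigr => c _ /=; rewrite sc.
  rewrite /=; apply/andP/eqP => [[/andP[st _] /eqP ce]|->].
    apply: val_inj; apply: (sorted_eq le_trans le_anti st (sort_sorted le_total _)).
    by apply/allP => c _; rewrite /= sc -ce cntE.
  have ceq : cnt (Tuple s0n) = e by apply/ffunP => c; apply: ord_inj; rewrite cntE /= sc.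
  rewrite ceq eqxx /= sort_sorted //=; split=> //.
  by rewrite (_ : [ffun _ => _] = [ffun c => val (e c)]) //; apply/ffunP => c; rewrite !ffunE sc.
move=> t /andP[_ Pt].
rewrite (eq_bigr (fun c => count_mem c t)) => [|c _]; last exact: cntE.
rewrite sum_cnt size_tuple eqxx /=.
rewrite (_ : [ffun _ => _] = [ffun c => count_mem c t]) //.
by apply/ffunP => c; rewrite ffunE [RHS]ffunE cntE.
Qed.

End SortedWords.

Section Multiplicity.

Variables (R : comNzRingType) (h : nat -> R).

Definition hpoly K : {poly R} := \sum_(k < K) h k *: 'X^k.

Lemma coef_hpolyX K r a : (hpoly K ^+ r)`_a =
  \sum_(e : {ffun 'I_r -> 'I_K} | (\sum_i e i == a)%N) \prod_i h (e i).
Proof.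
rewrite -[r in LHS]card_ord -prodr_const bigA_distr_bigA coef_sum [RHS]big_mkcond.
apply: eq_bigr => e _.
have -> : \prod_i (h (e i) *: 'X^(e i)) = (\prod_i h (e i)) *: 'X^(\sum_i e i) :> {poly R}.
  rewrite scaler_prod; congr (_ *: _).
  by elim/big_rec2: _ => [//|i x y _ ->]; rewrite exprD.
by rewrite coefZ coefXn eq_sym; case: eqP => _; rewrite ?mulr1 ?mulr0.
Qed.

(** Choosing for each letter its multiplicity in each of the r factors amounts to choosing one array
    of multiplicities indexed by pairs (factor, letter). *)
Lemma prod_coef_hpolyX K r L (mu : {ffun 'I_L -> nat}) :
  \prod_a (hpoly K ^+ r)`_(mu a) =
  \sum_(e : {ffun 'I_r * 'I_L -> 'I_K} | [forall a, (\sum_i e (i, a) == mu a)%N])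
    \prod_c h (e c).
Proof.
under eq_bigr => a _ do rewrite coef_hpolyX.
rewrite bigA_distr_big_dep /=.
pose cur (e : {ffun 'I_r * 'I_L -> 'I_K}) : {ffun 'I_L -> {ffun 'I_r -> 'I_K}} :=
  [ffun a => [ffun i => e (i, a)]].
rewrite (reindex cur) /=; last first.
  exists (fun f : {ffun 'I_L -> {ffun 'I_r -> 'I_K}} => [ffun c : 'I_r * 'I_L => f c.2 c.1]) => f _.
    by apply/ffunP => -[i a]; rewrite !ffunE.
  by apply/ffunP => a; apply/ffunP => i; rewrite !ffunE.
apply: eq_big => [e|e _].
  apply: eq_forallb => a; rewrite unfold_in; congr (_ == _).
  by apply: eq_bigr => i _; rewrite !ffunE.
rewrite exchange_big pair_big; apply: eq_bigr => -[i a] _.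
by rewrite !ffunE.
Qed.

End Multiplicity.

(** * Cutting words at separators into blocks *)

Section Cells.

Variables (L N M r : nat).
Hypotheses (r_gt0 : (0 < r)%N) (rM : (r < M)%N).
Local Notation cell := ('I_r * 'I_L)%type.
Implicit Types (w : {ffun 'I_N.+1 -> 'I_L}).

(** Inside a block the indices are listed in nonincreasing order, because [gapb 0] vanishes on a
    rise. *)
Definition le_cell (x y : cell) : bool :=
  (x.1 < y.1)%N || ((x.1 == y.1) && (y.2 <= x.2)%N).

Lemma le_cell_total : total le_cell.
Proof.
move=> [i a] [j b]; rewrite /le_cell /= -!(inj_eq val_inj) /=.
by case: (ltngtP i j) => //= _; apply: leq_total.
Qed.

Lemma le_cell_anti : antisymmetric le_cell.
Proof.
move=> [i a] [j b]; rewrite /le_cell /= -!(inj_eq val_inj) /=.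
by case: (ltngtP i j) => //= /ord_inj -> /anti_leq/ord_inj ->.
Qed.

Lemma le_cell_trans : transitive le_cell.
Proof. by move=> [j b] [i a] [k c]; rewrite /le_cell /= -!(inj_eq val_inj) /=; lia. Qed.

Local Notation wi := (widen_ord (leqnSn N)).
Local Notation li := (lift (@ord0 N)).

Lemma nxt_widen (i : 'I_N) : nxt (wi i) = li i.
Proof.
apply: val_inj; rewrite /= /bump /= add1n modnDmr modn_small addn1 //.
by rewrite ltnS ltn_ord.
Qed.

(* The word is cut at one of the separators of the last gap; [B p] is then the number
   of separators between the cut and the letter at position p. *)
Lemma sum_gaps_blocks w :
  \sum_(b : {ffun 'I_N.+1 -> 'I_M} | (\sum_p b p == r)%N)
     (b ord_max)%:R * \prod_p gapb (b p) (w p) (w (nxt p)) =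
  \sum_(B : {ffun 'I_N.+1 -> 'I_r}) (1 - 'X) *
     \prod_(i < N) adj (1 - 'X) le_cell (B (wi i), w (wi i)) (B (li i), w (li i)).
Proof.
pose z0 : 'I_r := Ordinal r_gt0.
pose zM : 'I_M := Ordinal (ltn_trans r_gt0 rM).
(* The component [bo.2] says where the last gap is cut: that many of its separators follow the
   marked one. *)
pose S (bo : {ffun 'I_N.+1 -> 'I_M} * 'I_r) p :=
  (bo.2 + \sum_(0 <= q < p) bo.1 (inord q))%N.
pose fit (bo : {ffun 'I_N.+1 -> 'I_M} * 'I_r) :=
  (\sum_p nat_of_ord (bo.1 p) == r)%N && (bo.2 < bo.1 ord_max)%N.
have S0 bo : S bo 0%N = bo.2 by rewrite /S big_geq ?addn0.
have inwi (i : 'I_N) : inord i = wi i.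
  by apply: val_inj; rewrite /= inordK // ltnS ltnW.
have inli (i : 'I_N) : inord i.+1 = li i.
  by apply: val_inj; rewrite /= inordK // ltnS ltn_ord.
have inmax : inord N = ord_max :> 'I_N.+1 by apply: val_inj; rewrite /= inordK.
have sumE (f : 'I_N.+1 -> nat) :
    (\sum_p f p = \sum_(0 <= q < N) f (inord q) + f ord_max)%N.
  by rewrite big_ord_recr /= big_mkord; congr addn; apply: eq_bigr => i _; rewrite inwi.
have Slt bo p : fit bo -> (p <= N)%N -> (S bo p < r)%N.
  case/andP=> /eqP; rewrite sumE /S => sr lt pN; move: sr.
  rewrite (@big_cat_nat _ _ _ p 0 N) //=; lia.
pose h' bo : {ffun 'I_N.+1 -> 'I_r} := [ffun p : 'I_N.+1 => insubd z0 (S bo p)].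
(* The gaps are recovered as differences of block numbers; the last gap receives what remains of
   r. *)
pose nb (B : {ffun 'I_N.+1 -> 'I_r}) (p : nat) : nat :=
  if (p < N)%N then (B (inord p.+1) - B (inord p))%N else (r - (B ord_max - B ord0))%N.
pose h (B : {ffun 'I_N.+1 -> 'I_r}) : {ffun 'I_N.+1 -> 'I_M} * 'I_r :=
  ([ffun p : 'I_N.+1 => insubd zM (nb B p)], B ord0).
have hE B p : (h B).1 p = nb B p :> nat.
  rewrite ffunE val_insubd; case: ltnP => //; rewrite /nb; case: ifP => _ le.
    have := ltn_ord (B (inord p.+1)); lia.
  lia.
have h'E bo p : fit bo -> h' bo p = S bo p :> nat.
  by move=> okb; rewrite ffunE val_insubd Slt // -ltnS.
have h'K bo : fit bo -> h (h' bo) = bo.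
  move=> okb; rewrite [RHS]surjective_pairing; congr pair.
    apply/ffunP => p; apply: ord_inj; rewrite -/((h (h' bo)).1 p) hE /nb.
    case: ifP => pN.
      rewrite !h'E // !inordK ?ltnS // 1?ltnW // /S big_nat_recr //= inord_val; lia.
    have -> : p = ord_max by apply: val_inj; have := ltn_ord p; rewrite /=; lia.
    rewrite !h'E // S0 /S /=; case/andP: okb => /eqP; rewrite sumE; lia.
  by apply: ord_inj; rewrite h'E // S0.
(* Exactly the weakly increasing [B] come from cut words; for any other [B] some factor [adj] is
   0. *)
pose mono (B : {ffun 'I_N.+1 -> 'I_r}) := [forall i, B (wi i) <= B (li i)]%N.
have h_mono B : fit (h B) && (h' (h B) == B) = mono B.
  apply/andP/forallP => [[okb /eqP <-] i|mB].
    rewrite !h'E // /S /= /bump /= add1n big_nat_recr //= addnA leq_addr //.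
  have mB' q : (q < N)%N -> (B (inord q) <= B (inord q.+1))%N.
    by move=> qN; have := mB (Ordinal qN); rewrite -inwi -inli.
  have in0 : inord 0 = ord0 :> 'I_N.+1 by apply: val_inj; rewrite /= inordK.
  have tele p : (p <= N)%N ->
      (B ord0 + \sum_(0 <= q < p) (h B).1 (inord q) = B (inord p))%N.
    elim: p => [|p IH] pN; first by rewrite big_geq // addn0 in0.
    rewrite big_nat_recr //= addnA IH 1?ltnW // -/((h B).1 (inord p)) hE /nb.
    have ip : (inord p : 'I_N.+1) = p :> nat by rewrite inordK // ltnS ltnW.
    by rewrite ip pN subnKC // mB'.
  have t0 := tele N (leqnn N); rewrite inmax in t0.
  have okb : fit (h B).
    have ltB := ltn_ord (B ord_max); apply/andP; rewrite sumE !hE /nb ltnn.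
    split; first by apply/eqP; lia.
    rewrite /=; lia.
  split=> //; apply/eqP/ffunP => p; apply: ord_inj; rewrite h'E // /S tele -1?ltnS //.
  by rewrite inord_val.
transitivity (\sum_(bo | fit bo) \prod_p gapb (bo.1 p) (w p) (w (nxt p))).
  transitivity (\sum_(b : {ffun 'I_N.+1 -> 'I_M} | (\sum_p b p == r)%N)
     \sum_(o : 'I_r | (o < b ord_max)%N) \prod_p gapb (b p) (w p) (w (nxt p))).
    apply: eq_bigr => b /eqP sb; rewrite sumr_const mulr_natl; congr (_ *+ _).
    rewrite -sum1_card -(big_ord_widen r (fun=> 1%N)) ?sum1_card ?card_ord //.
    by move: sb; rewrite sumE; lia.
  by rewrite pair_big_dep.
rewrite (reindex_onto h h' h'K) (eq_bigl _ _ h_mono).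
rewrite [RHS](bigID mono) /= [X in _ = _ + X]big1 ?addr0 => [|B]; last first.
  rewrite negb_forall => /existsP[i]; rewrite -ltnNge => lt.
  rewrite (bigD1 i) //= /adj xpair_eqE /le_cell /= ltnNge ltnW //=.
  by rewrite -!(inj_eq val_inj) /= gtn_eqF // mul0r mulr0.
apply: eq_bigr => B /forallP mB; rewrite big_ord_recr [LHS]mulrC /=; congr (_ * _).
  rewrite -/((h B).1 ord_max) hE /nb ltnn /gapb.
  by have := ltn_ord (B ord_max); case: eqP => //; lia.
apply: eq_bigr => i _; rewrite -/((h B).1 (wi i)) hE /nb /= ltn_ord inli inwi nxt_widen.
rewrite /gapb /adj /le_cell xpair_eqE subn_eq0 /= -!(inj_eq val_inj) /=.
have := mB i; rewrite leq_eqVlt => /orP[/eqP ->|lt].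
  rewrite leqnn eqxx ltnn /=; case: eqP => // _; case: ltnP => //.
by rewrite leqNgt lt /= ltn_eqF.
Qed.

(** Letters paired with their block numbers form a word of cells. By [path_weight] it counts only
    when sorted, with 1 - t for each distinct cell, and [sum_sorted_tuples] turns sorted words into
    multiplicities. *)
Lemma sum_cells (mu : {ffun 'I_L -> nat}) : (\sum_a mu a = N.+1)%N ->
  gapU N M r mu = \prod_a (hpoly (wt0 (1 - 'X)) N.+2 ^+ r)`_(mu a).
Proof.
move=> smu.
rewrite /gapU (eq_bigr _ (fun w _ => sum_gaps_blocks w)) prod_coef_hpolyX.
pose P (e : {ffun cell -> nat}) := [forall a, (\sum_i e (i, a) == mu a)%N].
transitivity (\sum_(t : N.+1.-tuple cell | sorted le_cell t && P [ffun c => count_mem c t])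
     \prod_c wt0 (1 - 'X : {poly rat}) (count_mem c t)); last first.
  rewrite (sum_sorted_tuples _ le_cell_total le_cell_anti le_cell_trans).
  apply: eq_bigl => e.
  have -> : P [ffun c => val (e c)] = [forall a, (\sum_i nat_of_ord (e (i, a)) == mu a)%N].
    by apply: eq_forallb => a; congr (_ == _); apply: eq_bigr => i _; rewrite ffunE.
  apply: andb_idl => /forallP h; apply/eqP; rewrite -[RHS]smu.
  transitivity (\sum_i \sum_a nat_of_ord (e (i, a)))%N.
    by rewrite pair_big; apply: eq_bigr => -[i a].
  by rewrite exchange_big; apply: eq_bigr => a _; apply/eqP.
pose h (t : N.+1.-tuple cell) : {ffun 'I_N.+1 -> 'I_L} * {ffun 'I_N.+1 -> 'I_r} :=
  ([ffun p => (tnth t p).2], [ffun p => (tnth t p).1]).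
have hbij : bijective h.
  exists (fun wB : {ffun 'I_N.+1 -> 'I_L} * {ffun 'I_N.+1 -> 'I_r} =>
     [tuple (wB.2 p, wB.1 p) | p < N.+1]) => [t|[w B]].
    by apply: eq_from_tnth => p; rewrite tnth_mktuple !ffunE; case: (tnth t p).
  by congr pair; apply/ffunP => p; rewrite ffunE tnth_mktuple.
rewrite pair_big /= (reindex h) /=; last exact: onW_bij.
rewrite [LHS]big_mkcond [RHS]big_mkcondl [RHS]big_mkcond; apply: eq_bigr => t _.
have -> : (vcont [ffun p => (tnth t p).2] == mu) && true = P [ffun c => count_mem c t].
  have cE a : (vcont [ffun p => (tnth t p).2] a = \sum_i count_mem (i, a) t)%N.
    rewrite ffunE.
    transitivity (\sum_(i < r) \sum_p (tnth t p == (i, a)))%N.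
      rewrite exchange_big /=; apply: eq_bigr => p _; rewrite ffunE.
      case: (tnth t p) => j c /=; rewrite (bigD1 j) //= xpair_eqE eqxx /=.
      by rewrite big1 ?addn0 // => i ne; rewrite xpair_eqE eq_sym (negbTE ne).
    apply: eq_bigr => i _; rewrite -sum1_count big_tuple [RHS]big_mkcond.
    by apply: eq_bigr => p _; rewrite /=; case: eqP.
  rewrite andbT; apply/eqP/forallP => [<- a|h1].
    by rewrite cE; apply/eqP/eq_bigr => i _; rewrite ffunE.
  apply/ffunP => a; rewrite cE -(eqP (h1 a)).
  by apply: eq_bigr => i _; rewrite ffunE.
case: ifP => // _.
case/tupleP: t => x s.
rewrite [RHS]/= -(path_weight _ le_cell_total le_cell_anti le_cell_trans).
rewrite [in RHS]size_tuple; congr (_ * _); apply: eq_bigr => i _.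
by rewrite !ffunE !(tnth_nth x) /= -!surjective_pairing.
Qed.

End Cells.

(** * Newton recursion, and the passage from all words to primitive ones *)

(** The coefficient form of y f'(y) = (\sum_i (1 - t^i) y^i) f(y) for f(y) = (1 - t y) / (1 - y). *)
Lemma wt0_newton j : j%:R * wt0 (1 - 'X) j =
  \sum_(i < j.+1) (1 - 'X^i) * wt0 (1 - 'X) (j - i) :> {poly rat}.
Proof.
have geo : \sum_(i < j) (1 - 'X^i) * (1 - 'X) = j%:R * (1 - 'X) - (1 - 'X^j) :> {poly rat}.
  elim: j => [|j IH]; first by rewrite big_ord0 expr0 mul0r subrr subr0.
  rewrite big_ord_recr /= IH -(addn1 j) natrD exprD expr1; ring.
rewrite big_ord_recr /= subnn {2}/wt0 /= mulr1.
rewrite (eq_bigr (fun i : 'I_j => (1 - 'X^i) * (1 - 'X))) => [|i _]; last first.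
  by rewrite /wt0 subn_eq0 leqNgt ltn_ord.
rewrite geo; case: j {geo} => [|j]; last by rewrite /wt0 /=; ring.
by rewrite expr0 !mul0r subrr subr0 addr0.
Qed.

(** Taking the r-th power multiplies the logarithmic derivative by r. This is the recursion that
    [prod_coef_newton] asks for, with y_k = r (1 - t^k); truncation at K is harmless for
    coefficients below K. *)
Lemma hpoly_newton K r a : (a < K)%N ->
  a%:R * (hpoly (wt0 (1 - 'X : {poly rat})) K ^+ r)`_a =
  \sum_(1 <= k < a.+1) (r%:R * (1 - 'X^k)) *
     (hpoly (wt0 (1 - 'X)) K ^+ r)`_(a - k).
Proof.
move=> aK; set f := hpoly _ K.
have sumE (c : nat -> {poly rat}) j : (j < K)%N ->
    (\sum_(k < K) c k *: 'X^k : {poly {poly rat}})`_j = c j.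
  move=> jK; rewrite coef_sum (bigD1 (Ordinal jK)) //= coefZ coefXn eqxx mulr1.
  rewrite big1 ?addr0 // => i; rewrite -(inj_eq val_inj) eq_sym coefZ coefXn /=.
  by move=> /negbTE ->; rewrite mulr0.
have fE j : (j < K)%N -> f`_j = wt0 (1 - 'X) j by apply: sumE.
pose y : {poly {poly rat}} := \sum_(k < K) (1 - 'X^k) *: 'X^k.
have yE j : (j < K)%N -> y`_j = 1 - 'X^j by apply: (sumE (fun k => 1 - 'X^k)).
have Xd (g : {poly {poly rat}}) j : ('X * g^`())`_j = j%:R * g`_j.
  by case: j => [|j]; rewrite coefXM ?mul0r //= coef_deriv mulr_natl.
have e1 : eqm K ('X * f^`()) (y * f).
  move=> j jK; rewrite Xd fE // wt0_newton coefM; apply: eq_bigr => i _.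
  by have := ltn_ord i => ij; rewrite yE ?fE //; lia.
have e2 : eqm K ('X * (f ^+ r)^`()) (r%:R * (y * f ^+ r)).
  case: r => [|r]; first by rewrite expr0 derivC mulr0 mul0r.
  have -> : 'X * (f ^+ r.+1)^`() = r.+1%:R * ('X * f^`() * f ^+ r).
    by rewrite deriv_exp /= -mulr_natl; ring.
  apply: eqmM => //; rewrite exprS mulrA; exact: eqmM.
have := e2 a aK; rewrite Xd => ->.
rewrite [r%:R * (y * _)]mulr_natl coefMn coefM -[LHS]mulr_natl mulr_sumr.
rewrite big_ord_recl yE ?(leq_ltn_trans _ aK) //.
rewrite expr0 subrr mul0r mulr0 add0r big_add1 /= big_mkord.
apply: eq_bigr => i _; rewrite /bump add1n yE ?mulrA //.
by have := ltn_ord i; lia.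
Qed.

Lemma Wpoly_main L N M (mu : {ffun 'I_L -> nat}) : (\sum_a mu a = N.+1)%N ->
  eqm M (Wpoly N mu) ([forall a, N.+1 %| mu a]%N%:R +
     N.+1%:R * \sum_(1 <= r < M) \sum_(nu <- intparts N.+1) Rterm mu r nu).
Proof.
move=> smu; apply: eqm_trans (@Wpoly_series _ _ _ _) _.
case: M => [//|M].
rewrite -(big_mkord xpredT (fun r => 'X^r * gapT N M.+1 r mu)) big_nat_recl //.
rewrite expr0 mul1r gapT0 // [in X in eqm _ _ X]big_add1 /= mulr_sumr.
apply: eqmD => //; rewrite !big_mkord; apply: eqm_sum => r _ j _.
congr (polyseq _)`_j.
have r0 : (r.+1)%:R != 0 :> {poly rat} by rewrite -polyC_natr polyC_eq0 pnatr_eq0.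
apply: (mulfI r0); rewrite mulrCA gapTU sum_cells ?ltnS ?ltn_ord //.
rewrite [RHS]mulrCA [LHS]mulrCA; congr (_ * _).
rewrite (@prod_coef_newton _ (fun k => r.+1%:R * (1 - 'X^k))
   (fun a => (hpoly (wt0 (1 - 'X)) N.+2 ^+ r.+1)`_a)); first last.
- by move=> a; rewrite smu -ltnS => aN; apply: hpoly_newton.
- rewrite coef_hpolyX (big_pred1 [ffun=> ord0]) => [|e].
    by rewrite big1 // => i _; rewrite ffunE.
  rewrite sum_nat_eq0; apply/forallP/eqP => [e0|-> p]; last by rewrite ffunE.
  by apply/ffunP => p; rewrite ffunE; apply/val_inj/eqP; have := e0 p.
rewrite smu !mulr_sumr; apply: eq_big_seq => nu; rewrite mem_intparts => /and3P[_ _ /eqP sn].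
rewrite /Rterm big_split /= -scalerAr [RHS]mulr_natl -[RHS]scaler_nat [RHS]scalerA.
(* Every part brings a factor r; one of them is the r by which both sides were multiplied, which
   leaves the exponent [(size nu).-1] of [Rterm]. *)
have -> : \prod_(i <- nu) r.+1%:R = (r.+1%:R ^+ size nu)%:P :> {poly rat}.
  by rewrite big_const_seq count_predT iter_mulr_1 polyC_exp polyC_natr.
have szE : size nu = (size nu).-1.+1 by rewrite prednK //; case: (nu) sn.
rewrite -[_%:P * _ * _]mulrA mul_polyC -scalerAr scalerA mulrA; congr (_ *: _).
by rewrite {1}szE exprS mulrCA.
Qed.

(** Both families give [Wpoly] when summed over d-th powers, and strong induction on the length
    cancels the terms with d > 1, in place of Mobius inversion. The correction at length 1 comes
    from the summand p_n. *)
Lemma Ppoly_Rpoly L N (mu : {ffun 'I_L -> nat}) : (\sum_a mu a = N.+1)%N ->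
  Ppoly N mu = Rpoly N.+1 mu + (N == 0)%N%:R.
Proof.
elim/ltn_ind: N mu => N IH mu smu.
have E : Wpoly N mu = [forall a, N.+1 %| mu a]%N%:R +
   \sum_(d <- divisors N.+1) if [forall a, d %| mu a]%N
         then Rpoly (N.+1 %/ d) [ffun a => mu a %/ d]%N \Po 'X^d else 0.
  apply: eqm_eq => M; apply: eqm_trans (Wpoly_main smu) _; apply: eqmD => //.
  exact/eqm_sym/Rpoly_sum.
(* The power sum p_n is p_1 at the n-th powers of the variables, so it belongs to d = n alone. *)
have E2 : [forall a, N.+1 %| mu a]%N%:R = \sum_(d <- divisors N.+1)
    if [forall a, d %| mu a]%N then ((N.+1 %/ d).-1 == 0)%N%:R else 0 :> {poly rat}.
  rewrite (bigD1_seq N.+1) ?divisors_uniq -?dvdn_divisors //= divnn /= big_seq_cond big1.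
    by rewrite addr0; case: ifP.
  move=> d /andP[]; rewrite -dvdn_divisors // => dn ne.
  case: ifP => // _; rewrite (_ : _ == _ = false) //.
  have d0 := dvdn_gt0 (ltn0Sn N) dn.
  have : (1 < N.+1 %/ d)%N by rewrite ltn_divRL // mul1n ltn_neqAle ne dvdn_leq.
  by case: (N.+1 %/ d)%N => [|[|]].
move: E; rewrite E2 -big_split /= Wpoly_prim.
rewrite !(bigD1_seq 1%N) ?divisors_uniq -?dvdn_divisors ?dvd1n //= divn1 /=.
have all1 : [forall a, 1 %| mu a]%N by apply/forallP => a; rewrite dvd1n.
have mu1 : [ffun a => mu a %/ 1]%N = mu by apply/ffunP => a; rewrite ffunE divn1.
rewrite all1 mu1 expr1 !comp_polyXr => E.
apply: (addIr (\sum_(i <- divisors N.+1 | i != 1%N)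
  if [forall a, i %| mu a]%N
  then Ppoly (N.+1 %/ i).-1 [ffun a => mu a %/ i]%N \Po 'X^i else 0)).
rewrite E [X in X + _ = _]addrC; congr (_ + _).
rewrite big_seq_cond [RHS]big_seq_cond; apply: eq_bigr => d /andP[].
rewrite -dvdn_divisors // => dn d1; have d0 := dvdn_gt0 (ltn0Sn N) dn.
case: forallP => [dv|_]; last by rewrite add0r.
have KE : ((N.+1 %/ d).-1.+1 = N.+1 %/ d)%N by rewrite prednK // divn_gt0 // dvdn_leq.
rewrite IH ?KE.
- by rewrite rmorphD rmorph_nat /= addrC.
- by rewrite -ltnS ltn_Pdiv // ltn_neqAle eq_sym d1.
apply/eqP; rewrite -(eqn_pmul2l d0) [X in _ == X]mulnC divnK // -[X in _ == X]smu big_distrr.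
by apply/eqP/eq_bigr => a _; rewrite ffunE /= mulnC divnK.
Qed.

(** * Cycles and primitive words *)

Section Rotations.

Variables (L N : nat).
Local Notation A := (bool * 'I_L)%type.
Implicit Type w : {ffun 'I_N.+1 -> A}.

(* Barred letters come first among the letters with the same value. *)
Definition key (x : A) : nat := (x.2.*2 + ~~ x.1)%N.

Lemma key_inj : injective key.
Proof.
move=> [b a] [c d]; rewrite /key /= => e.
have ad : a = d by apply: ord_inj; case: b c e => [] []; lia.
by rewrite ad in e *; case: b c e => [] [] //=; lia.
Qed.

Lemma key_lt x : (key x < L.*2)%N.
Proof. by have := ltn_ord x.2; rewrite /key; case: x.1 => /=; lia. Qed.

(* [rotv w x / rotc] is the number with periodic base-[rotb] expansion
   [key (w x), key (w x.+1), ...]: comparing such numbers compares the rotations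
   of [w] lexicographically.  The digit [rotb - 1] never occurs, so that the
   expansions are unique. *)
Definition rotb := L.*2.+1.

Definition rotc := (rotb ^ N.+1).-1.

Definition rotv w x := (\sum_(l < N.+1) key (w (inZp (x + l))) * rotb ^ (N - l))%N.

Lemma rotv_rec w x : (rotb * rotv w x = key (w (inZp x)) * rotc + rotv w x.+1)%N.
Proof.
have e : (rotb * rotv w x + key (w (inZp x)) =
          key (w (inZp x)) * rotb ^ N.+1 + rotv w x.+1)%N.
  rewrite /rotv big_ord_recl [in RHS]big_ord_recr /= addn0 subn0 subnn muln1.
  rewrite addSn -addnS inZp_per addnA; congr (_ + _)%N.
  rewrite mulnDr big_distrr /= expnS mulnCA; congr (_ + _)%N.
  apply: eq_bigr => l _; rewrite /bump add1n addSn addnS mulnCA -expnS; congr (_ * rotb ^ _)%N.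
  by have := ltn_ord l; lia.
move: e; rewrite -[(rotb ^ N.+1)%N]prednK ?expn_gt0 // -/rotc mulnS; lia.
Qed.

Lemma rotv_lt w x : (rotv w x < rotc)%N.
Proof.
have gen m (f : nat -> nat) : (forall l, f l < L.*2)%N ->
    ((\sum_(l < m) f l * rotb ^ (m.-1 - l)).+1 <= rotb ^ m - (0 < m))%N.
  move=> lt; elim: m => [|m IH]; first by rewrite big_ord0.
  rewrite big_ord_recr /= subnn muln1.
  have -> : (\sum_(l < m) f l * rotb ^ (m - l) = rotb * \sum_(l < m) f l * rotb ^ (m.-1 - l))%N.
    rewrite big_distrr; apply: eq_bigr => l _; rewrite /= mulnCA -expnS.
    by congr (_ * rotb ^ _)%N; have := ltn_ord l; lia.
  move: IH; move: (\sum_(l < m) _)%N => D IH; have {}IH : (D.+1 <= rotb ^ m)%N by lia.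
  have := lt m; rewrite expnS; have : (rotb * D.+1 <= rotb * rotb ^ m)%N by rewrite leq_mul.
  by rewrite mulnS; move: (rotb * D)%N (rotb * rotb ^ m)%N => u v; rewrite /rotb; lia.
by have := gen N.+1 (fun l => key (w (inZp (x + l)))) (fun l => key_lt _); rewrite subn1.
Qed.

Lemma rotv_ltk w x y : (key (w (inZp x)) < key (w (inZp y)))%N -> (rotv w x < rotv w y)%N.
Proof.
move=> lt; rewrite -(ltn_pmul2l (m := rotb)) // !rotv_rec.
have := leq_mul lt (leqnn rotc); have := rotv_lt w x.+1; rewrite mulSn; lia.
Qed.

Lemma rotv_ltS w x y : w (inZp x) = w (inZp y) ->
  (rotv w x < rotv w y)%N = (rotv w x.+1 < rotv w y.+1)%N.
Proof.
by move=> e; rewrite -(ltn_pmul2l (m := rotb)) // !rotv_rec e ltn_add2l.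
Qed.

Lemma rotv_eq w x y : rotv w x = rotv w y -> w (inZp x) = w (inZp y).
Proof.
move=> e; apply: key_inj; case: (ltngtP (key (w (inZp x))) (key (w (inZp y)))) => //;
by move/rotv_ltk; rewrite e ltnn.
Qed.

Lemma rotv_eqS w x y : rotv w x = rotv w y -> rotv w x.+1 = rotv w y.+1.
Proof.
move=> e; have e1 := rotv_rec w x; have := rotv_rec w y.
by rewrite -e e1 (rotv_eq e) => /addnI.
Qed.

Lemma rotv_per w x : rotv w (x + N.+1) = rotv w x.
Proof. by apply: eq_bigr => l _; rewrite addnAC inZp_per. Qed.

(** If two rotations agree, the distance of their starting points is a period, and so is its gcd
    with the length; primitivity makes this gcd the full length. *)
Lemma rotv_prim w x y : prim w -> rotv w x = rotv w y -> x = y %[mod N.+1].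
Proof.
move=> /allP pw; wlog le : x y / (x <= y)%N.
  move=> H; case/orP: (leq_total x y) => le e; first exact: H.
  by apply/esym/H.
move=> e; have eqs l : rotv w (x + l) = rotv w (y + l).
  by elim: l => [|l IH]; rewrite ?addn0 // !addnS; apply: rotv_eqS.
have per : period w (y - x)%N.
  apply/periodP => z.
  have zE u : inZp (u + x * N.+1) = inZp u :> 'I_N.+1.
    by apply: val_inj; rewrite /= addnC modnMDl.
  rewrite -zE -[in RHS]zE.
  (* After x full turns the two positions are x + l and y + l with the same l. *)
  have -> : (z + x * N.+1 = x + (z + x * N))%N by lia.
  have -> : (z + (y - x) + x * N.+1 = y + (z + x * N))%N by lia.
  by apply/esym/rotv_eq.
apply/eqP; rewrite eq_sym eqn_mod_dvd //; apply: contraT => nd.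
have d0 : (0 < y - x)%N by rewrite lt0n; apply: contraNneq nd => ->; rewrite dvdn0.
have pg := period_gcd d0 per (period_size w).
have := pw (gcdn (y - x) N.+1); rewrite -dvdn_divisors // dvdn_gcdr pg implybF => /(_ isT).
rewrite -leqNgt => le2; case/negP: nd.
have -> : N.+1 = gcdn (y - x) N.+1; last exact: dvdn_gcdl.
by apply/eqP; rewrite eqn_leq le2 /= dvdn_leq // dvdn_gcdr.
Qed.

(** After a barred letter the key does not drop. If the rotation decreased nevertheless, the next
    letter would be the same, again barred with a decreasing rotation, and so on: a strict decrease
    all around the cycle. The unbarred case is symmetric. *)
Lemma rotv_barred w x : (0 < N)%N -> prim w -> good w ->
  (rotv w x < rotv w x.+1)%N = (w (inZp x)).1.
Proof.
move=> N0 pw /goodP gw.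
have neq y : rotv w y != rotv w y.+1.
  apply/eqP => /(rotv_prim pw) /eqP; rewrite eq_sym eqn_mod_dvd // subSnn dvdn1.
  by rewrite eqSS; lia.
have kle y : (w (inZp y)).1 -> (key (w (inZp y)) <= key (w (inZp y.+1)))%N.
  by have := gw y; rewrite /ok /key => + b1; rewrite b1 /=; lia.
have kge y : ~~ (w (inZp y)).1 -> (key (w (inZp y.+1)) <= key (w (inZp y)))%N.
  by have := gw y; rewrite /ok /key => + b1; rewrite (negbTE b1) /=; lia.
have [b|b] := boolP (w (inZp x)).1.
  apply: contraT; rewrite -leqNgt leq_eqVlt eq_sym (negbTE (neq x)) /= => lt.
  have H k : (w (inZp (x + k))).1 /\ (rotv w (x + k).+1 < rotv w (x + k))%N.
    elim: k => [|k [bk ltk]]; first by rewrite addn0.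
    rewrite addnS; have := kle _ bk; rewrite leq_eqVlt.
    case/orP=> [/eqP/key_inj e|/rotv_ltk]; last by lia.
    by rewrite -e -rotv_ltS.
  have H2 k : (rotv w (x + k.+1) < rotv w x)%N.
    elim: k => [|k IH]; first by rewrite addn1.
    by rewrite addnS; have [_ h] := H k.+1; apply: ltn_trans IH.
  by have := H2 N; rewrite rotv_per ltnn.
apply/negbTE; apply/negP => lt.
have H k : ~~ (w (inZp (x + k))).1 /\ (rotv w (x + k) < rotv w (x + k).+1)%N.
  elim: k => [|k [bk ltk]]; first by rewrite addn0.
  rewrite addnS; have := kge _ bk; rewrite leq_eqVlt.
  case/orP=> [/eqP/key_inj e|/rotv_ltk]; last by lia.
  by rewrite e -rotv_ltS.
have H2 k : (rotv w x < rotv w (x + k.+1))%N.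
  elim: k => [|k IH]; first by rewrite addn1.
  by rewrite addnS; have [_ h] := H k.+1; apply: ltn_trans h.
by have := H2 N; rewrite rotv_per ltnn.
Qed.

(** For primitive words the rotations are distinct, and their ranks become the points on which the
    cycle acts. *)
Definition rank w (p : 'I_N.+1) : 'I_N.+1 := inord #|[set q : 'I_N.+1 | rotv w q < rotv w p]%N|.

Lemma rankE w p : rank w p = #|[set q : 'I_N.+1 | rotv w q < rotv w p]%N| :> nat.
Proof.
rewrite inordK // -[X in (_ < X)%N](card_ord N.+1) -[X in (_ < X)%N]cardsT.
by apply: proper_card; apply/properP; split=> //; exists p; rewrite // inE ltnn.
Qed.

Lemma rank_lt w (p q : 'I_N.+1) : (rotv w p < rotv w q)%N -> (rank w p < rank w q)%N.
Proof.
move=> lt; rewrite !rankE; apply: proper_card; apply/properP; split.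
  by apply/fintype.subsetP => x; rewrite !inE => /ltn_trans; apply.
by exists p; rewrite inE ?ltnn.
Qed.

Lemma rank_ltE w (p q : 'I_N.+1) : prim w -> (rank w p < rank w q)%N = (rotv w p < rotv w q)%N.
Proof.
move=> pw; case: (ltngtP (rotv w p) (rotv w q)) => [/rank_lt//|/rank_lt|e].
  by move/ltnW; rewrite leqNgt => /negbTE.
have -> : p = q.
  by apply: ord_inj; have := rotv_prim pw e; rewrite !modn_small.
by rewrite ltnn.
Qed.

Lemma rank_inj w : prim w -> injective (rank w).
Proof.
move=> pw p q e; apply: ord_inj.
suff /(rotv_prim pw) : rotv w p = rotv w q by rewrite !modn_small.
by case: (ltngtP (rotv w p) (rotv w q)) => // /rank_lt; rewrite e ltnn.
Qed.

End Rotations.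

(** * The bijection between long cycles with a starting point and primitive words *)

Section Necklaces.

Variables (L N : nat) (v : 'I_N.+1 -> 'I_L).
Hypotheses (N_gt0 : (0 < N)%N) (v_mono : {homo v : p q / (p <= q)%N}).
Local Notation A := (bool * 'I_L)%type.
Implicit Types (s : 'S_N.+1) (w : {ffun 'I_N.+1 -> A}).

Definition lett s (p : 'I_N.+1) : A := ((p < s p)%N, v p).

Definition long_cycle s := porbit s ord0 == setT.

(** Points are ordered as their letters and, on a tie, as their images; iterating this, as the
    letter sequences read along the cycle. By [Fword_compat] this is the condition defining
    F_Dex. *)
Definition compat s := [forall p : 'I_N.+1, forall q : 'I_N.+1, (p < q)%N ==>
  (key (lett s p) <= key (lett s q))%N && ((lett s p == lett s q) ==> (s p < s q)%N)].

Definition wd (si : 'S_N.+1 * 'I_N.+1) : {ffun 'I_N.+1 -> A} :=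
  [ffun p : 'I_N.+1 => lett si.1 ((si.1 ^+ p)%g si.2)].

Definition vmu : {ffun 'I_L -> nat} := [ffun a => \sum_p (v p == a)]%N.

Section Forward.

Variables (s : 'S_N.+1) (i : 'I_N.+1).
Hypotheses (cs : long_cycle s) (ks : compat s).
Local Notation orb x := ((s ^+ x)%g i).

Lemma orbS x : orb x.+1 = s (orb x).
Proof. by rewrite expgSr permM. Qed.

Lemma porbitT j : porbit s j = setT.
Proof.
apply/eqP; rewrite -(eqP cs) eq_sym eq_porbit_mem porbit_sym (eqP cs) inE //.
Qed.

Lemma orb_per x : orb (x + N.+1) = orb x.
Proof.
have e : (s ^+ N.+1)%g i = i.
  by have := iter_porbit s i; rewrite porbitT cardsT card_ord -permX.
by rewrite addnC expgD permM e.
Qed.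

Lemma orb_mod x : orb (x %% N.+1) = orb x.
Proof.
rewrite [in RHS](divn_eq x N.+1) addnC; elim: (x %/ _)%N => [|k IH]; first by rewrite addn0.
by rewrite mulSn addnCA addnC orb_per.
Qed.

Lemma orb_surj j : exists p : 'I_N.+1, orb p = j.
Proof.
have : j \in porbit s i by rewrite porbitT inE.
by case/porbitP => x ->; exists (inZp x); rewrite /= orb_mod.
Qed.

Definition orbf (p : 'I_N.+1) := orb p.

Lemma orb_bij : bijective orbf.
Proof.
have inv j : {p | orbf p == j}.
  by apply: sigW; case: (orb_surj j) => p <-; exists p.
have can : cancel (fun j => sval (inv j)) orbf by move=> j; apply/eqP; case: (inv j).
by apply: (bij_can_bij (injF_bij (can_inj can)) can).
Qed.

Lemma wd_inZp x : wd (s, i) (inZp x) = lett s (orb x).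
Proof. by rewrite ffunE /= orb_mod. Qed.

Lemma wd_good : good (wd (s, i)).
Proof.
apply/goodP => x; rewrite !wd_inZp orbS /ok /lett /=.
by case: ltnP => [/ltnW|]; apply: v_mono.
Qed.

Lemma wd_cont : cont (wd (s, i)) = vmu.
Proof.
apply/ffunP => a; rewrite !ffunE [RHS](reindex orbf) /=; last exact/onW_bij/orb_bij.
by apply: eq_bigr => p _; rewrite ffunE.
Qed.

Lemma wd_bars : bars (wd (s, i)) = exc s.
Proof.
rewrite /exc -sum1_card big_mkcond /= (reindex orbf) /=; last exact/onW_bij/orb_bij.
by apply: eq_bigr => p _; rewrite ffunE inE /=; case: ltnP.
Qed.

Lemma compatP (p q : 'I_N.+1) : (p < q)%N ->
  (key (lett s p) <= key (lett s q))%N /\ (lett s p = lett s q -> (s p < s q)%N).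
Proof.
move=> lt; have /forallP/(_ p)/forallP/(_ q) := ks; rewrite lt => /andP[h1 /implyP h2].
by split=> // /eqP.
Qed.

(** Points e steps apart on the orbit would carry the same letters forever, so [compat] would
    preserve their order and make every e-th point of the orbit strictly monotone, which is
    impossible in a finite set. *)
Lemma wd_prim : prim (wd (s, i)).
Proof.
apply/allP => e; rewrite -dvdn_divisors // => en; apply/implyP => lt.
have e0 : (0 < e)%N by apply: dvdn_gt0 en.
apply/negP => /periodP per.
have {}per x : lett s (orb (x + e)) = lett s (orb x) by rewrite -!wd_inZp.
have ne : orb 0 != orb e.
  have lt0 : (0 < N.+1)%N by [].
  apply/eqP => eq; have := bij_inj orb_bij (x1 := Ordinal lt0) (x2 := Ordinal lt) eq.
  by move=> [] h; rewrite -h in e0.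
case: (ltngtP (orb 0) (orb e)) => [lt1|gt1|/ord_inj/eqP]; last by rewrite (negbTE ne).
- have H x : (orb x < orb (x + e))%N.
    elim: x => [|x IH] //; rewrite addSn !orbS; apply: (compatP IH).2.
    by rewrite per.
  have H2 k : (k <= orb (k * e))%N.
    elim: k => [|k IH] //; rewrite mulSn addnC; exact: leq_ltn_trans IH (H _).
  by have := leq_trans (ltn_ord (orb (N.+1 * e))) (H2 N.+1); rewrite ltnn.
- have H x : (orb (x + e) < orb x)%N.
    elim: x => [|x IH] //; rewrite addSn !orbS; apply: (compatP IH).2.
    by rewrite per.
  have H2 k : (k + orb (k * e) <= orb 0)%N.
    elim: k => [|k IH] //; rewrite mulSn addnC [(e + _)%N]addnC addnS; apply: leq_trans IH.
    by rewrite addnC ltn_add2l.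
  have := leq_trans (leq_addr _ _) (H2 N.+1); rewrite leqNgt.
  by rewrite (ltn_ord (orb 0)).
Qed.

(** If the first letters agree, passing to the next rotations multiplies the difference of the
    values by [rotb]. The difference stays below [rotc], so the induction on the room left ends at a
    position where the letters differ. *)
Lemma orb_lt x y : (rotv (wd (s, i)) x < rotv (wd (s, i)) y)%N -> (orb x < orb y)%N.
Proof.
set w := wd _; move em: (rotc L N - (rotv w y - rotv w x))%N => m.
elim/ltn_ind: m x y em => m IH x y em lt.
have yc := rotv_lt w y; have yc1 := rotv_lt w y.+1.
case: (ltngtP (key (w (inZp x))) (key (w (inZp y)))) => [ltk|gtk|/key_inj e].
- rewrite ltnNge leq_eqVlt; apply/negP => /orP[/eqP/ord_inj e|/compatP[]].
    by move: ltk; rewrite !wd_inZp e ltnn.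
  by rewrite leqNgt -!wd_inZp ltk.
- by have := rotv_ltk gtk; lia.
have lt1 : (rotv w x.+1 < rotv w y.+1)%N by rewrite -rotv_ltS.
have gap : (rotv w y - rotv w x < rotv w y.+1 - rotv w x.+1)%N.
  have L0 : (0 < L.*2)%N by rewrite double_gt0; apply: leq_ltn_trans (ltn_ord (v ord0)).
  have : (L.*2 * rotv w x < L.*2 * rotv w y)%N by rewrite ltn_pmul2l.
  by have := rotv_rec w x; have := rotv_rec w y; rewrite e /rotb !mulSn; lia.
have dec : (rotc L N - (rotv w y.+1 - rotv w x.+1) < m)%N by lia.
have := IH _ dec _ _ erefl lt1; rewrite !orbS => lts.
rewrite ltnNge leq_eqVlt; apply/negP => /orP[/eqP/ord_inj e1|/compatP[_]].
  by move: lts; rewrite e1 ltnn.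
by rewrite -!wd_inZp -/w e => /(_ erefl); lia.
Qed.

(** The orbit orders positions as [rotv] does, so the rank of [p] is the number of points below
    [orb p], which is [orb p] itself. Hence the word determines the cycle. *)
Lemma orb_rank (p : 'I_N.+1) : orb p = rank (wd (s, i)) p.
Proof.
apply: ord_inj; rewrite rankE.
have -> : #|[set q : 'I_N.+1 | rotv (wd (s, i)) q < rotv (wd (s, i)) p]%N| =
   #|[set q | orbf q < orbf p]%N|.
  apply: eq_card => q; rewrite !inE; apply/idP/idP => [/orb_lt//|lt].
  case: (ltngtP (rotv (wd (s, i)) q) (rotv (wd (s, i)) p)) => // [/orb_lt|].
    by move: lt; rewrite /orbf; lia.
  move=> /(rotv_prim wd_prim); rewrite !modn_small // => /ord_inj e.
  by move: lt; rewrite e ltnn.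
rewrite -/(orbf p); move: (orbf p) => m.
have -> : [set q | orbf q < m]%N = orbf @^-1: [set j : 'I_N.+1 | j < m]%N.
  by apply/setP => q; rewrite !inE.
rewrite on_card_preimset; last exact/onW_bij/orb_bij.
rewrite cardsE -sum1_card -(big_ord_widen N.+1 (fun=> 1%N)) ?sum1_card ?card_ord //.
exact: ltnW.
Qed.

End Forward.

Lemma mono_count_eq (u : 'I_N.+1 -> 'I_L) : {homo u : p q / (p <= q)%N} ->
  (forall a, \sum_p (u p == a) = \sum_p (v p == a))%N -> u =1 v.
Proof.
move=> u_mono cE.
pose sq (f : 'I_N.+1 -> 'I_L) := mkseq (fun k => nat_of_ord (f (inord k))) N.+1.
have sq_sorted (f : 'I_N.+1 -> 'I_L) : {homo f : p q / (p <= q)%N} -> sorted leq (sq f).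
  move=> f_mono; apply/(sortedP 0%N) => k; rewrite size_mkseq => kN.
  rewrite /sq (nth_mkseq _ _ kN) (nth_mkseq _ _ (ltnW kN)); apply: f_mono.
  by rewrite !inordK // ltnW.
have cntE (f : 'I_N.+1 -> 'I_L) a : count_mem a (sq f) = (\sum_p (nat_of_ord (f p) == a))%N.
  transitivity (\sum_(p < N.+1) (nat_of_ord (f (inord p)) == a))%N; last first.
    by apply: eq_bigr => p _; rewrite inord_val.
  rewrite -(big_mkord xpredT (fun k => nat_of_bool (nat_of_ord (f (inord k)) == a))).
  rewrite count_map -sum1_count big_mkcond /index_iota subn0.
  by apply: eq_bigr => k _; rewrite /=; case: eqP.
have pm : perm_eq (sq u) (sq v).
  apply/allP => a _; apply/eqP; rewrite [LHS]cntE [RHS]cntE.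
  case: (ltnP a L) => [aL|La]; first exact: (cE (Ordinal aL)).
  by rewrite !big1 // => p _; apply/eqP; rewrite eqb0; apply/eqP => e;
     have := ltn_ord (v p); have := ltn_ord (u p); lia.
have e : sq u = sq v.
  by apply: (sorted_eq leq_trans anti_leq _ _ pm); apply: sq_sorted.
move=> p; apply: ord_inj; have := congr1 (fun t => nth 0%N t p) e.
by rewrite !nth_mkseq // inord_val.
Qed.

(** The use of [pick] gives a total function; for primitive [w] the ranks are distinct and the
    permutation sought exists, by [cyc_ofE]. *)
Definition cyc_of w : 'S_N.+1 :=
  odflt 1%g [pick s : 'S_N.+1 | [forall p, s (rank w p) == rank w (nxt p)]].

Section Backward.

Variable w : {ffun 'I_N.+1 -> A}.
Hypotheses (pw : prim w) (gw : good w) (cw : cont w = vmu).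

Lemma cyc_ofE p : cyc_of w (rank w p) = rank w (nxt p).
Proof.
rewrite /cyc_of; case: pickP => [s /forallP/(_ p)/eqP //|/= none].
have nxt_inj : injective (@nxt N) by apply: addIr.
pose r := perm (rank_inj pw).
have := none (r^-1 * perm nxt_inj * r)%g; case/negP; apply/forallP => q.
have -> : rank w q = r q by rewrite permE.
by rewrite !permM permK !permE.
Qed.

Lemma rank_surj j : exists p, rank w p = j.
Proof.
pose r := perm (rank_inj pw).
by exists ((r^-1)%g j); have := permKV r j; rewrite permE.
Qed.

Lemma rotv_nxt (p : 'I_N.+1) : rotv w (nxt p) = rotv w p.+1.
Proof.
apply: eq_bigr => l _; congr (key (w _) * _)%N.
by rewrite inZpD [RHS]inZpD -nxt_inZp !valZpK.
Qed.

(** In order of rank the values of the letters are nondecreasing, with the same multiplicities as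
    [v], and such a sequence is unique. *)
Lemma v_rank p : v (rank w p) = (w p).2.
Proof.
pose r := perm (rank_inj pw).
have rE q : r q = rank w q by rewrite permE.
have -> : (w p).2 = (w ((r^-1)%g (rank w p))).2 by rewrite -rE permK.
apply/esym/(@mono_count_eq (fun j => (w ((r^-1)%g j)).2)) => [j k le|a].
  rewrite leqNgt; apply/negP => lt.
  have kl : (key (w ((r^-1)%g k)) < key (w ((r^-1)%g j)))%N.
    by rewrite /key; case: (w _).1; case: (w _).1 => /=; lia.
  rewrite -[in X in (X < _)%N](valZpK ((r^-1)%g k)) in kl.
  rewrite -[in X in (_ < X)%N](valZpK ((r^-1)%g j)) in kl.
  by have := rank_lt (rotv_ltk kl); rewrite -!rE !permKV; lia.
have := congr1 (fun f : {ffun 'I_L -> nat} => f a) cw; rewrite !ffunE => <-.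
rewrite (reindex_inj (@perm_inj _ r)) /=.
by apply: eq_bigr => q _; rewrite permK.
Qed.

Lemma lett_rank p : lett (cyc_of w) (rank w p) = w p.
Proof.
rewrite /lett cyc_ofE rank_ltE // rotv_nxt rotv_barred // v_rank valZpK.
by case: (w p).
Qed.

Lemma cyc_ofX x : (cyc_of w ^+ x)%g (rank w (inZp 0)) = rank w (inZp x).
Proof.
by elim: x => [|x IH]; rewrite ?expg0 ?perm1 // expgSr permM IH cyc_ofE nxt_inZp.
Qed.

Lemma cyc_of_long : long_cycle (cyc_of w).
Proof.
have pT : porbit (cyc_of w) (rank w (inZp 0)) = setT.
  apply/setP => j; rewrite inE; case: (rank_surj j) => p <-.
  by rewrite -[p]valZpK -cyc_ofX mem_porbit.
by rewrite /long_cycle -pT eq_porbit_mem pT inE.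
Qed.

Lemma cyc_of_compat : compat (cyc_of w).
Proof.
apply/forallP => j; apply/forallP => k; apply/implyP.
case: (rank_surj j) => p <-; case: (rank_surj k) => q <-; rewrite !lett_rank rank_ltE // => lt.
apply/andP; split.
  rewrite leqNgt; apply/negP; rewrite -[in X in (X < _)%N](valZpK q) -[in X in (_ < X)%N](valZpK p).
  by move/rotv_ltk; lia.
apply/implyP => /eqP e; rewrite !cyc_ofE rank_ltE // !rotv_nxt -rotv_ltS //.
by rewrite !valZpK.
Qed.

Lemma cyc_ofK : wd (cyc_of w, rank w (inZp 0)) = w.
Proof. by apply/ffunP => p; rewrite ffunE /= cyc_ofX valZpK lett_rank. Qed.

End Backward.

(** The map [wd] is a bijection from compatible long cycles with a starting point; the N.+1 starting
    points give the factor. *)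
Lemma necklace_sum :
  N.+1%:R * \sum_(s : 'S_N.+1 | long_cycle s && compat s) 'X^(exc s) = Ppoly N vmu.
Proof.
rewrite /Ppoly (reindex_onto wd (fun w => (cyc_of w, rank w (inZp 0)))) /=; last first.
  by move=> w /and3P[gw pw /eqP cw]; apply: cyc_ofK.
transitivity (\sum_(si : 'S_N.+1 * 'I_N.+1 | long_cycle si.1 && compat si.1)
    'X^(exc si.1) : {poly rat}).
  transitivity (\sum_(s : 'S_N.+1 | long_cycle s && compat s)
      \sum_(i : 'I_N.+1) 'X^(exc s) : {poly rat}).
    by rewrite mulr_sumr; apply: eq_bigr => s _; rewrite sumr_const card_ord mulr_natl.
  by rewrite pair_big /=; apply: eq_bigl => -[s i]; rewrite andbT.
apply: eq_big => [[s i]|[s i] /andP[cs _]] /=; last by rewrite wd_bars.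
apply/andP/andP => [[cs ks]|[/and3P[gw pw /eqP cw] /eqP[<- _]]]; last first.
  by rewrite cyc_of_long ?cyc_of_compat.
have pw := wd_prim i cs ks.
split; first by rewrite wd_good // pw wd_cont // eqxx.
have rE (p : 'I_N.+1) := orb_rank i cs ks p.
apply/eqP; congr pair; last by rewrite -rE /= mod0n expg0 perm1.
apply/permP => j; case: (orb_surj i cs j) => p <-.
by rewrite {1}rE cyc_ofE // -{1}[p]valZpK nxt_inZp -rE /= orb_mod // orbS.
Qed.

End Necklaces.

(** * The expansion of Q_((n),j) *)

Local Open Scope fset_scope.
Local Open Scope mset_scope.
Local Open Scope ring_scope.

(* The letters are reversed because the words j_1 >= ... >= j_n are decreasing. *)
Definition rcont (L : nat) (m : {mset nat}) : {ffun 'I_L -> nat} :=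
  [ffun a => m (rev_ord a)].

Lemma psum_psumf L (nu : seq nat) (m : {mset nat}) :
  0%N \notin nu -> {in finsupp m, forall i, i < L}%N ->
  psum nu m = (psumf nu (rcont L m))%:R.
Proof.
elim: nu m => [|k nu IH] m /=.
  move=> _ sm; rewrite /pser1; congr (nat_of_bool _)%:R.
  apply/eqP/eqP => [->|/ffunP e]; first by apply/ffunP => a; rewrite !ffunE mset0E.
  apply/msetP => i; rewrite mset0E; case: (boolP (i \in finsupp m)) => [im|].
    have iL := sm _ im; have := e (rev_ord (Ordinal iL)).
    by rewrite !ffunE rev_ordK.
  by rewrite memNfinsupp => /eqP.
rewrite inE negb_or eq_sym -lt0n => /andP[k0 nz] sm; rewrite {1}/pser_mul.
(* Only divisors of the form x_i^k contribute, and they have i < L by the bound on the support. *)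
have step : \sum_(a <- mdivisors m) psum1 k a * psum nu (m `\` a) =
   \sum_(i < L) \sum_(a <- mdivisors m) (a == msetn k (val i))%:R * psum nu (m `\` a).
  rewrite exchange_big; apply: eq_big_seq => a; rewrite in_mdivisors => am.
  rewrite -mulr_suml; congr (_ * _); rewrite /psum1.
  case: (boolP [exists i : 'I_L, a == msetn k (val i)]) => [/existsP[i /eqP ae]|ne].
    rewrite [RHS](bigD1 i) //= ae eqxx [X in _ = _ + X]big1 ?addr0; last first.
      move=> j ji; rewrite (_ : _ == _ = false) //; apply/negbTE/eqP => /msetP/(_ j).
      by rewrite !msetnE eqxx (inj_eq val_inj) (negbTE ji); lia.
    have fs : finsupp (msetn k (val i)) = [fset val i].
      apply/fsetP => j; rewrite mem_finsupp msetnE inE.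
      by have [_|_] := eqVneq j (val i); rewrite ?eqxx // -lt0n.
    by rewrite fs big_seq_fset1 eqxx.
  rewrite [RHS]big1 => [|i _]; last first.
    by rewrite (_ : _ == _ = false) //; apply: contraNF ne => e; apply/existsP; exists i.
  rewrite big_seq big1 // => i ia; rewrite (_ : _ == _ = false) //.
  apply: contraNF ne => e.
  have iL : (i < L)%N.
    apply: sm; move: ia; rewrite !mem_finsupp -!lt0n => ia.
    by apply: leq_trans ia _; move/msubsetP: am.
  by apply/existsP; exists (Ordinal iL).
rewrite step natr_sum (reindex_inj rev_ord_inj) [RHS]big_mkcond; apply: eq_bigr => i _.
rewrite ffunE; set j := rev_ord i.
have le : (msetn k (val j) `<=` m) = (k <= m j)%N.
  apply/msubsetP/idP => [/(_ (val j))|le x]; rewrite msetnE ?eqxx //.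
  by case: eqP => // ->.
case: ifP => kj.
  rewrite (bigD1_seq (msetn k (val j))) ?fset_uniq ?in_mdivisors ?le //=.
  rewrite eqxx mul1r big1 ?addr0 => [|a /negbTE ->]; last by rewrite mul0r.
  rewrite IH //.
    congr (psumf _ _)%:R; apply/ffunP => b; rewrite !ffunE msetE2 msetnE.
    rewrite -(inj_eq rev_ord_inj b i) -/j -(inj_eq val_inj) /=.
    by case: eqP; rewrite ?muln1 ?muln0.
  move=> x; rewrite mem_finsupp msetE2 => h; apply: sm; rewrite mem_finsupp.
  by apply: contraNneq h => ->.
rewrite big_seq big1 // => a; rewrite in_mdivisors => am.
rewrite (_ : _ == _ = false) ?mul0r //; apply: contraFF kj => /eqP e.
by rewrite -le -e.
Qed.

Lemma long_cycleE N (s : 'S_N.+1) : (cycle_type s == [:: N.+1]) = long_cycle s.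
Proof.
apply/eqP/eqP => [ct|lc].
  have pm : perm_eq [seq #|C| | C : {set 'I_N.+1} in porbits s] [:: N.+1].
    by rewrite -ct perm_sym perm_sort.
  apply/eqP; rewrite eqEcard subsetT cardsT card_ord /=.
  have : #|porbit s ord0| \in [seq #|C| | C : {set 'I_N.+1} in porbits s].
    by apply/imageP; exists (porbit s ord0) => //; apply: imset_f.
  by rewrite (perm_mem pm) inE => /eqP ->.
rewrite /cycle_type (_ : porbits s = [set setT]).
  by rewrite /image_mem enum_set1 /= cardsT card_ord.
apply/setP => C; rewrite inE; apply/imsetP/eqP => [[i _ ->]|->].
  by apply: porbitT; apply/eqP.
by exists ord0.
Qed.

Lemma exc_lt N (s : 'S_N.+1) : (exc s < N.+1)%N.
Proof.
rewrite -[X in (_ < X)%N](card_ord N.+1) -[X in (_ < X)%N]cardsT /exc.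
apply: proper_card; apply/properP; split=> //; exists ord_max => //.
by rewrite inE -leqNgt -ltnS.
Qed.

(** An index word counted by F_S is weakly decreasing, and a monomial has only one such
    arrangement. *)
Lemma Fqsym_count n (S : {set 'I_n.-1}) (m : {mset nat}) :
  Fqsym S m = (Fword S (sort geq m))%:R.
Proof.
have geq_trans : transitive geq by move=> x y z; rewrite /geq /=; lia.
have geq_anti : antisymmetric geq by move=> x y; rewrite /geq /=; lia.
have geq_total : total geq by move=> x y; rewrite /geq /=; lia.
rewrite /Fqsym; congr (_%:R).
set jm := sort geq m.
have jmin : jm \in permutations m by rewrite mem_permutations perm_sort.
rewrite (@eq_in_count _ _ (fun j => (j == jm) && Fword S jm)) => [|j]; last first.
  rewrite mem_permutations => jp; apply/idP/andP => [Fj|[/eqP -> //]].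
  suff e : j = jm by rewrite -e.
  have jjm : perm_eq j jm by rewrite perm_sym perm_sort perm_sym.
  apply: (sorted_eq geq_trans geq_anti _ (sort_sorted geq_total _) jjm).
  case/andP: Fj => /eqP sj /forallP Fj; apply/(sortedP 0%N) => i iS.
  have iN : (i < n.-1)%N by rewrite -sj; move: iS; case: (size j).
  by have := Fj (Ordinal iN); rewrite /geq /=; case: ifP => // _ /ltnW.
case: (Fword S jm); last by under eq_count do rewrite andbF; rewrite count_pred0.
under eq_count do rewrite andbT.
by rewrite count_uniq_mem ?permutations_uniq // jmin.
Qed.

(* Comparing keys, with ties broken by [s], is transitive: this extends the
   condition of [Fword] on consecutive positions to all pairs of positions. *)
Lemma Fword_compat L N (s : 'S_N.+1) (j : seq nat) (v : 'I_N.+1 -> 'I_L) :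
  sorted geq j -> size j = N.+1 ->
  (forall p : 'I_N.+1, nth 0%N j p = rev_ord (v p)) ->
  Fword (Dex s) j = compat v s.
Proof.
move=> sj szj vE.
pose rl (p q : 'I_N.+1) := (key (lett v s p) < key (lett v s q))%N ||
  ((lett v s p == lett v s q) && (s p < s q)%N).
have rl_trans : transitive rl.
  move=> q p r; rewrite /rl => /orP[lt1|/andP[/eqP -> lt1]] /orP[lt2|/andP[/eqP <- lt2]].
  - by rewrite (ltn_trans lt1).
  - by rewrite lt1.
  - by rewrite lt2.
  - by rewrite eqxx (ltn_trans lt1) // orbT.
have compatE : compat v s = [forall p : 'I_N.+1, forall q : 'I_N.+1, (p < q)%N ==> rl p q].
  apply: eq_forallb => p; apply: eq_forallb => q; congr (_ ==> _); rewrite /rl.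
  rewrite leq_eqVlt (inj_eq (@key_inj _)).
  by have [->|] := eqVneq (lett v s p) (lett v s q); rewrite ?ltnn ?andbT ?orbF.
(* When neighbouring indices are equal, the bars and then the images decide, which is the comparison
   of letters in [Dex]. *)
have stepE (i : 'I_N.+1.-1) : (if i \in Dex s
    then (nth 0%N j (pos_next i) < nth 0%N j (pos i))%N
    else (nth 0%N j (pos_next i) <= nth 0%N j (pos i))%N) = rl (pos i) (pos_next i).
  have le : (nth 0%N j (pos_next i) <= nth 0%N j (pos i))%N.
    move/(sortedP 0%N): sj => /(_ i); apply; rewrite szj; exact: pos_next_subproof.
  rewrite inE /lt_letter /word /= !inE /rl /lett xpair_eqE /key /=.
  have sinj : (s (pos i) < s (pos_next i))%N = ~~ (s (pos_next i) < s (pos i))%N.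
    case: (ltngtP (s (pos i)) (s (pos_next i))) => // /ord_inj/perm_inj/(congr1 val) /=.
    by lia.
  have e1 := vE (pos i); have e2 := vE (pos_next i); rewrite /= in e1 e2 le.
  rewrite e1 e2 in le *.
  have va := ltn_ord (v (pos i)); have vb := ltn_ord (v (pos_next i)).
  rewrite sinj -(inj_eq val_inj (v _)) /=.
  move: (s (pos_next i) < s (pos i))%N (i < s (pos i))%N
    (i.+1 < s (pos_next i))%N => b1 b2 b3.
  by case: b1 b2 b3 => [] [] [] /=; lia.
rewrite /Fword szj eqxx compatE andTb; apply/forallP/forallP => [h p|h i]; last first.
  by rewrite stepE; have /forallP/(_ (@pos_next N.+1 i)) := h (@pos N.+1 i); rewrite ltnSn.
apply/forallP => q; apply/implyP => pq.
have h1 k : (k < N)%N -> rl (inord k) (inord k.+1).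
  move=> kN; have := h (Ordinal kN); rewrite stepE.
  have -> : pos (Ordinal kN : 'I_N.+1.-1) = inord k.
    by apply: val_inj; rewrite /= inordK // ltnS ltnW.
  have -> // : pos_next (Ordinal kN : 'I_N.+1.-1) = inord k.+1.
  by apply: val_inj; rewrite /= inordK.
have h2 d : (p + d < N)%N -> rl p (inord (p + d).+1).
  elim: d => [|d IH] dN; first by rewrite addn0 in dN *; have := h1 _ dN; rewrite inord_val.
  apply: (rl_trans (inord (p + d).+1)); first by apply: IH; rewrite addnS in dN; apply: ltnW.
  by rewrite addnS in dN *; apply: h1.
have qE : (q = (p + (q - p.+1)).+1 :> nat)%N by lia.
rewrite -[q]inord_val qE; apply: h2; have := ltn_ord q; lia.
Qed.

Lemma Qsym_long_cycles N (m : {mset nat}) :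
  \sum_(j < N.+1) 'X^j * Qsym N.+1 [:: N.+1] j m =
  \sum_(s : 'S_N.+1 | long_cycle s && Fword (Dex s) (sort geq m)) 'X^(exc s).
Proof.
under eq_bigr => j _ do rewrite /Qsym mulr_sumr.
rewrite (exchange_big_dep (fun s : 'S_N.+1 => cycle_type s == [:: N.+1])) /=; last first.
  by move=> j s _ /andP[].
rewrite (eq_bigl _ _ (@long_cycleE N)) [RHS]big_mkcondr; apply: eq_bigr => s lc.
rewrite (big_pred1 (Ordinal (exc_lt s))) => [|j]; last first.
  by rewrite long_cycleE lc /= -(inj_eq val_inj) eq_sym.
by rewrite Fqsym_count; case: (Fword _ _); rewrite ?mulr1 ?mulr0.
Qed.

Local Open Scope mset_scope.

Theorem theorem4p1 (n : nat) (n_gt1 : (1 < n)%N) (m : {mset nat}) :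
  \sum_(j < n) 'X^j * Qsym n [:: n] j m =
  \sum_(nu <- intparts n) ((zee nu)%:R^-1 : rat) *: (Gpoly nu * psum nu m).
Proof.
case: n n_gt1 => // N; rewrite ltnS => N0; rewrite Qsym_long_cycles.
(* No index occurring in [m] exceeds their sum, so this many variables suffice. *)
pose L := (sumn m).+1.
have suppE i : (i \in finsupp m) = (i \in (m : seq nat)).
  by rewrite mem_finsupp -count_mem_mset -lt0n -has_count has_pred1.
have mL : {in finsupp m, forall i, i < L}%N.
  by move=> i; rewrite suppE => im; rewrite ltnS; apply: mem_leq_sumn.
have -> : \sum_(nu <- intparts N.+1) ((zee nu)%:R^-1 : rat) *: (Gpoly nu * psum nu m) =
  \sum_(nu <- intparts N.+1) ((zee nu)%:R^-1 : rat) *: (Gpoly nu * (psumf nu (rcont L m))%:R).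
  apply: eq_big_seq => nu; rewrite mem_intparts => /and3P[_ nz _].
  by rewrite (psum_psumf nz mL).
have sumE : (\sum_a rcont L m a = size m)%N.
  rewrite (reindex_inj rev_ord_inj) size_mset.
  rewrite (eq_bigr (fun a : 'I_L => m (val a))) => [|a _]; last by rewrite ffunE rev_ordK.
  rewrite -(big_mkord xpredT (fun a => m a)) (bigID (fun a => a \in finsupp m)) /=.
  rewrite [X in (_ + X)%N]big1 ?addn0 => [|a]; last by rewrite memNfinsupp => /eqP.
  rewrite -big_filter; apply: perm_big; apply: uniq_perm.
  - by rewrite filter_uniq ?iota_uniq.
  - exact: fset_uniq.
  by move=> a; rewrite mem_filter mem_index_iota /=; case: (boolP (a \in finsupp m)) => // /mL.
(* Monomials of degree other than n have coefficient 0 on both sides. *)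
have [szm|szm] := eqVneq (size m) N.+1; last first.
  rewrite big1 => [|s /andP[_ /andP[]]]; last by rewrite size_sort (negbTE szm).
  rewrite big_seq big1 // => nu; rewrite mem_intparts => /and3P[_ _ /eqP sn].
  have [->|/psumf_sum] := eqVneq (psumf nu (rcont L m)) 0%N; first by rewrite mulr0 scaler0.
  by rewrite sumE sn => e; rewrite e eqxx in szm.
have geq_trans : transitive geq by move=> x y z; rewrite /geq /=; lia.
have geq_refl : reflexive geq by move=> x; rewrite /geq /=.
have geq_total : total geq by move=> x y; rewrite /geq /=; lia.
pose jm := sort geq m.
have szj : size jm = N.+1 by rewrite size_sort.
have sj : sorted geq jm by apply: sort_sorted.
pose v (p : 'I_N.+1) : 'I_L := rev_ord (inord (nth 0%N jm p)).
have vE (p : 'I_N.+1) : nth 0%N jm p = rev_ord (v p).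
  rewrite rev_ordK inordK //; apply: mL; rewrite suppE -(mem_sort geq).
  by apply: mem_nth; rewrite szj.
clearbody v; have v_mono : {homo v : p q / (p <= q)%N}.
  move=> p q pq; have := sorted_leq_nth geq_trans geq_refl 0%N sj p q.
  rewrite !inE szj !ltn_ord => /(_ isT isT pq); rewrite /geq /= !vE /=.
  have := ltn_ord (v p); have := ltn_ord (v q); lia.
have vmuE : vmu v = rcont L m.
  apply/ffunP => a; rewrite !ffunE -count_mem_mset.
  have /seq.permP <- : perm_eq jm m by rewrite perm_sort.
  rewrite -sum1_count (big_nth 0%N) szj [RHS]big_mkcond [RHS]big_mkord; apply: eq_bigr => p _.
  have -> : (v p == a) = pred1 (val (rev_ord a)) (nth 0%N jm p).
    by rewrite vE [RHS](inj_eq (@ord_inj _)) (inj_eq rev_ord_inj).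
  by case: (pred1 _ _).
have n0 : (N.+1)%:R != 0 :> {poly rat} by rewrite -polyC_natr polyC_eq0 pnatr_eq0.
apply: (mulfI n0); rewrite -/(Rpoly N.+1 (rcont L m)).
rewrite (eq_bigl (fun s => long_cycle s && compat v s)); last first.
  by move=> s; rewrite (Fword_compat s sj szj vE).
(* The correction at length 1 vanishes because n > 1. *)
by rewrite (necklace_sum N0 v_mono) vmuE Ppoly_Rpoly ?sumE // eqn0Ngt N0 addr0.
Qed.
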